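(* Let $n=3$, $G=SO(6)$, and let $N_6^+$ be the space of traceless symmetric complex $6\times6$ matrices. Then the space $\left(\bigwedge (N_{6}^+)^*\otimes N_{6}^+\right)^G$ is not a free module over the subalgebra of $\left(\bigwedge (N_{6}^+)^*\right)^G$ generated by the invariants $T_1$ (of degree $5$) and $Q$ (of degree $6$).
   Context: $G=SO(6)$ (complex) acts on matrices by conjugation. $\bigwedge^k (N_6^+)^*\otimes R$ (for $R=\mathbb C$ or $R=N_6^+$) is identified with alternating $k$-linear maps $(N_6^+)^k\to R$. A scalar-valued alternating map $F$ of degree $h$ acts on an $R$-valued one $H$ of degree $k$ by $$(F\wedge H)(v_1,\dots,v_{h+k})=\frac1{h!k!}\sum_{\sigma\in S_{h+k}}\epsilon_\sigma F(v_{\sigma(1)},\dots,v_{\sigma(h)})H(v_{\sigma(h+1)},\dots,v_{\sigma(h+k)}).$$ $T_1(X_1,\dots,X_5)=\mathrm{Tr}\left(\sum_{\sigma\in S_5}\epsilon_\sigma X_{\sigma(1)}\cdots X_{\sigma(5)}\right)$. The polarized pfaffian $Q(Y_1,Y_2,Y_3)$ is the symmetric trilinear function on complex $6\times 6$ matrices that depends only on the skew parts $(Y_i-Y_i^t)/2$ and is the full polarization of the pfaffian there, normalized so that $Q(u_1\otimes u_2,u_3\otimes u_4,u_5\otimes u_6)=\det[u_1,\dots,u_6]$ for $u_i\in\mathbb C^6$, with $u\otimes v=uv^t$. The invariant $Q$ (same letter) is $Q=\sum_{\sigma\in S_6}\epsilon_\sigma\,Q([X_{\sigma(1)},X_{\sigma(2)}],[X_{\sigma(3)},X_{\sigma(4)}],[X_{\sigma(5)},X_{\sigma(6)}])$.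 *)

(* Defs.v *)
From HB Require Import structures.
From mathcomp Require Import all_boot all_order all_algebra all_fingroup.
From mathcomp Require Import boolp classical_sets reals.
From mathcomp Require Import complex.

Set Implicit Arguments.
Unset Strict Implicit.
Unset Printing Implicit Defensive.

Import Order.TTheory GRing.Theory Num.Theory.
Local Open Scope ring_scope.

Section SymmetricTraceless.
Variables (C : numFieldType) (n : nat).

Definition symtl_pred : {pred 'M[C]_n} :=
  fun X => (X^T == X) && (\tr X == 0).

Fact symtl_submod_closed : submod_closed symtl_pred.
Proof.
split=> [|a X Y]; rewrite !unfold_in.
  by rewrite trmx0 raddf0 !eqxx.
case/andP=> /eqP sX /eqP tX /andP[/eqP sY /eqP tY].
by rewrite linearP /= sX sY linearP /= tX tY mulr0 addr0 !eqxx.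
Qed.
HB.instance Definition _ :=
  GRing.isSubmodClosed.Build C 'M[C]_n symtl_pred symtl_submod_closed.

Record symtl := SymTl { symtl_val :> 'M[C]_n; _ : symtl_val \in symtl_pred }.
HB.instance Definition _ := [isSub for symtl_val].
HB.instance Definition _ := [Choice of symtl by <:].
HB.instance Definition _ := [SubChoice_isSubLmodule of symtl by <:].

Definition SO := {g : 'M[C]_n | (g *m g^T == 1%:M) && (\det g == 1)}.

Fact conj_symtl_subproof (g : SO) (X : symtl) :
  val g *m val X *m invmx (val g) \in symtl_pred.
Proof.
case: g X => g /= /andP[/eqP gg _] [X /= /andP[/eqP sX /eqP tX]].
have gU : g \in unitmx by case/mulmx1_unit: gg.
have -> : invmx g = g^T by rewrite -[RHS](mulKmx gU) gg mulmx1.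
rewrite unfold_in !trmx_mul trmxK sX mulmxA eqxx /=.
by rewrite mxtrace_mulC mulmxA (mulmx1C gg) mul1mx tX.
Qed.

Definition conj_symtl (g : SO) (X : symtl) : symtl :=
  SymTl (conj_symtl_subproof g X).

End SymmetricTraceless.

Arguments symtl : clear implicits.
Arguments SO : clear implicits.

Section Forms.
Variables (C : numFieldType) (N : lmodType C).

(* The component of degree k of F : form V is F k; the degree-k part of the   *)
(* exterior algebra on the dual of N, with coefficients in V, is cut out by   *)
(* the predicates multilinear and alternating below. Since N will have finite *)
(* dimension, an alternating k-linear map is 0 for k large, so that the       *)
(* product over all k taken here agrees with the direct sum.                  *)
Definition form (V : lmodType C) := forall k : nat, ('I_k -> N) -> V.

Section FormModule.
Variable V : lmodType C.

HB.instance Definition _ := gen_eqMixin (form V).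
HB.instance Definition _ := gen_choiceMixin (form V).

Definition form_add (F G : form V) : form V := fun k v => F k v + G k v.
Definition form_opp (F : form V) : form V := fun k v => - F k v.
Definition form_scale (a : C) (F : form V) : form V := fun k v => a *: F k v.

Lemma formP (F G : form V) : (forall k v, F k v = G k v) -> F = G.
Proof. by move=> FG; apply: functional_extensionality_dep => k; apply/funext. Qed.

Fact form_addA : associative form_add.
Proof. by move=> F G H; apply: formP => k v; rewrite /form_add addrA. Qed.
Fact form_addC : commutative form_add.
Proof. by move=> F G; apply: formP => k v; rewrite /form_add addrC. Qed.
Fact form_add0 : left_id (fun _ _ => 0) form_add.
Proof. by move=> F; apply: formP => k v; rewrite /form_add add0r. Qed.
Fact form_addN : left_inverse (fun _ _ => 0) form_opp form_add.
Proof. by move=> F; apply: formP => k v; rewrite /form_add addNr. Qed.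
HB.instance Definition _ :=
  GRing.isZmodule.Build (form V) form_addA form_addC form_add0 form_addN.

Fact form_scaleA a b F :
  form_scale a (form_scale b F) = form_scale (a * b) F.
Proof. by apply: formP => k v; rewrite /form_scale scalerA. Qed.
Fact form_scale1 : left_id 1 form_scale.
Proof. by move=> F; apply: formP => k v; rewrite /form_scale scale1r. Qed.
Fact form_scaleDr : right_distributive form_scale +%R.
Proof. by move=> a F G; apply: formP => k v; apply: scalerDr. Qed.
Fact form_scaleDl F : {morph form_scale^~ F : a b / a + b}.
Proof. by move=> a b; apply: formP => k v; apply: scalerDl. Qed.
HB.instance Definition _ := GRing.Zmodule_isLmodule.Build C (form V)
  form_scaleA form_scale1 form_scaleDr form_scaleDl.

Definition upd k (v : 'I_k -> N) (i : 'I_k) (x : N) : 'I_k -> N :=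
  fun j => if j == i then x else v j.

Definition multilinear k (f : ('I_k -> N) -> V) :=
  forall v i a x y,
    f (upd v i (a *: x + y)) = a *: f (upd v i x) + f (upd v i y).

Definition alternating k (f : ('I_k -> N) -> V) :=
  forall v i j, i != j -> v i = v j -> f v = 0.

Lemma multilinear_altsum k (f : ('I_k -> N) -> V) : multilinear f ->
  multilinear (fun v => \sum_(s : 'S_k) (-1) ^+ s *: f (fun i => v (s i))).
Proof.
move=> fL v i a x y; rewrite scaler_sumr -big_split /=; apply: eq_bigr => s _.
have E z : (fun j => upd v i z (s j)) =
    upd (fun j => v (s j)) ((s^-1)%g i) z.
  by apply/funext => j; rewrite /upd (canF_eq (permK s)).
by rewrite !E fL scalerDr !scalerA mulrC.
Qed.

Lemma alternating_altsum k (f : ('I_k -> N) -> V) :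
  alternating (fun v => \sum_(s : 'S_k) (-1) ^+ s *: f (fun i => v (s i))).
Proof.
move=> v i j ij vij; set S := LHS.
have : S = - S.
  rewrite {1}/S (reindex_inj (mulIg (tperm i j))) -sumrN.
  apply: eq_bigr => s _; rewrite odd_permM odd_tperm ij signr_addb mulrN1.
  rewrite scaleNr; congr (- (_ *: f _)); apply/funext => l; rewrite permM.
  by case: tpermP => [->|->|//].
by move/eqP; rewrite -addr_eq0 -mulr2n -scaler_nat scaler_eq0 pnatr_eq0 => /eqP.
Qed.

(* f placed in degree k, all other components being 0 *)
Definition homog k (f : ('I_k -> N) -> V) : form V := fun m v =>
  if @eqP nat k m is ReflectT e then f (fun i => v (cast_ord e i)) else 0.

Definition wedge_homog h k (f : ('I_h -> N) -> C^o) (g : ('I_k -> N) -> V)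
    (v : 'I_(h + k) -> N) : V :=
  (h`!%:R * k`!%:R)^-1 *: \sum_(s : 'S_(h + k)) (-1) ^+ s *:
    ((f (fun i => v (s (lshift k i))) : C) *: g (fun j => v (s (rshift h j)))).

(* subnKC (leq_ord h) : h + (m - h) = m *)
Definition wedge (F : form C^o) (H : form V) : form V := fun m v =>
  \sum_(h < m.+1)
    wedge_homog (F h) (H (m - h)%N)
      (fun i => v (cast_ord (subnKC (leq_ord h)) i)).

End FormModule.

Definition form1 : form C^o := homog (fun _ : 'I_0 -> N => 1).

Definition subalgebra (A : set (form C^o)) :=
  [/\ A form1,
      forall a F G, A F -> A G -> A (a *: F + G)
    & forall F G, A F -> A G -> A (wedge F G)].

Definition generated_subalgebra (S : set (form C^o)) : set (form C^o) :=
  smallest subalgebra S.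

(* M is free over A for the action wedge: it has a basis B, not required to   *)
(* be finite or homogeneous.                                                  *)
Definition free_module V (A : set (form C^o)) (M : set (form V)) :=
  exists B : set (form V),
  [/\ (B `<=` M)%classic,
      forall x, M x -> exists (m : nat) (a : 'I_m -> form C^o)
        (b : 'I_m -> form V),
        [/\ forall j, A (a j), forall j, B (b j)
          & x = \sum_(j < m) wedge (a j) (b j)]
    & forall (m : nat) (a : 'I_m -> form C^o) (b : 'I_m -> form V),
        (forall j, A (a j)) -> (forall j, B (b j)) -> injective b ->
        \sum_(j < m) wedge (a j) (b j) = 0 -> forall j, a j = 0].

End Forms.

Section Covariants.
Variables (C : numFieldType) (n : nat) (V : lmodType C).

(* The invariants of SO(n) in the tensor product of the exterior algebra on   *)
(* the dual of symtl C n with V, where SO(n) acts on V by act.                *)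
Definition covariants (act : SO C n -> V -> V) : set (form (symtl C n) V) :=
  [set F | forall k, [/\ multilinear (F k), alternating (F k)
    & forall g v, F k (fun i => conj_symtl g (v i)) = act g (F k v)]]%classic.

Lemma homog_covariants (act : SO C n -> V -> V) k
    (f : ('I_k -> symtl C n) -> V) :
  (forall g, act g 0 = 0) -> multilinear f -> alternating f ->
  (forall g v, f (fun i => conj_symtl g (v i)) = act g (f v)) ->
  covariants act (homog f).
Proof.
move=> act0 fL fA fG m; rewrite /homog; case: eqP => [e|_]; last first.
  by split=> [v i a x y|//|g v]; rewrite ?act0 ?scaler0 ?addr0.
case: m / e.
have -> : (fun v : 'I_k -> symtl C n => f (fun i => v (cast_ord (erefl k) i))) = f.
  apply/funext => v; congr f; apply/funext => i.
  by rewrite cast_ord_id.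
by [].
Qed.

End Covariants.

Section Invariants.
Variable C : numFieldType.
Local Notation N := (symtl C 6).
Local Notation "# k" := (@Ordinal 6 k isT) (at level 2, format "# k").

Definition T1_fun (v : 'I_5 -> N) : C^o :=
  \tr (\sum_(s : 'S_5) (-1) ^+ s *: \prod_(i < 5) val (v (s i))).

Definition T1 : form N C^o := homog T1_fun.

Lemma T1_funE v : T1_fun v =
  \sum_(s : 'S_5) (-1) ^+ s *: (\tr (\prod_(i < 5) val (v (s i))) : C^o).
Proof.
by rewrite /T1_fun raddf_sum; apply: eq_bigr => s _; exact: mxtraceZ.
Qed.

Lemma T1_covariants : covariants (fun _ => id) T1.
Proof.
have fE : T1_fun = (fun v => \sum_(s : 'S_5) (-1) ^+ s *:
  (\tr (\prod_(i < 5) val (v (s i))) : C^o)) by apply/funext=> v; exact: T1_funE.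
apply: homog_covariants => //; rewrite ?fE.
- apply: (@multilinear_altsum _ _ _ 5
    (fun v => \tr (\prod_(i < 5) val (v i)) : C^o)) => v i a x y.
  rewrite !big_ord_recl !big_ord0 /upd.
  case: i => [[|[|[|[|[|//]]]]] ilt];
    by rewrite -!val_eqE /= ?mulrDl ?mulrDr ?mulrDl -?scalerAl -?scalerAr linearP.
- exact: (@alternating_altsum _ _ _ 5
    (fun v => \tr (\prod_(i < 5) val (v i)) : C^o)).
move=> g v; apply: eq_bigr => s _; congr (_ *: _).
case: g => g hg /=; have /andP[/eqP /mulmx1_unit[gU _] _] := hg.
have E (r : seq 'I_5) : \prod_(i <- r) (g *m val (v (s i)) *m invmx g) =
    g *m (\prod_(i <- r) val (v (s i))) *m invmx g.
  elim: r => [|i r IH]; first by rewrite !big_nil mulmx1 mulmxV.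
  rewrite !big_cons IH -!mulmxE !mulmxA; congr (_ *m _ *m _).
  by rewrite mulmxKV.
by rewrite E mxtrace_mulC mulmxA mulVmx // mul1mx.
Qed.

Definition pfaffian6 (Y : 'M[C]_6) : C :=
  (2 ^+ 3 * 3`!%:R)^-1 * \sum_(s : 'S_6) (-1) ^+ s *
    (Y (s #0) (s #1) * Y (s #2) (s #3) * Y (s #4) (s #5)).

(* The trilinear function determined by its values polpf_rank1 on rank one    *)
(* matrices; the lemmas below check that it is symmetric, that it depends     *)
(* only on the skew parts, and that it polarizes (48 times) the pfaffian.     *)
Definition polpf (Y1 Y2 Y3 : 'M[C]_6) : C :=
  \sum_(s : 'S_6) (-1) ^+ s *
    (Y1 (s #0) (s #1) * Y2 (s #2) (s #3) * Y3 (s #4) (s #5)).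

Definition skew_part (Y : 'M[C]_6) : 'M[C]_6 := 2^-1 *: (Y - Y^T).

Lemma polpf_rank1 (u : 'I_6 -> 'cV[C]_6) :
  polpf (u #0 *m (u #1)^T) (u #2 *m (u #3)^T) (u #4 *m (u #5)^T) =
  \det (\matrix_(i, j) u j i 0).
Proof.
rewrite -det_tr /determinant /polpf; apply: eq_bigr => s _; congr (_ * _).
rewrite !big_ord_recl big_ord0 !mxE !big_ord1 !mxE.
have E (k : nat) (i : 'I_6) (h : (k < 6)%N) :
  nat_of_ord i = k -> i = Ordinal h by move=> e; apply: val_inj.
rewrite (E 0%N ord0 isT) // (E 1%N (lift _ _) isT) //.
rewrite (E 2%N (lift _ (lift _ _)) isT) //.
rewrite (E 3%N (lift _ (lift _ (lift _ _))) isT) //.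
rewrite (E 4%N (lift _ (lift _ (lift _ (lift _ _)))) isT) //.
rewrite (E 5%N (lift _ _) isT) //.
by rewrite mulr1 !mulrA.
Qed.

Lemma polpf_linear Y2 Y3 : linear (fun Y => polpf Y Y2 Y3 : C^o).
Proof.
move=> a X Y; rewrite /polpf scaler_sumr -big_split /=; apply: eq_bigr => s _.
rewrite 2!mxE !mulrDl mulrDr; congr (_ + _).
by rewrite -!mulrA mulrCA.
Qed.

Lemma polpf_reindex (t : 'S_6) Y1 Y2 Y3 : polpf Y1 Y2 Y3 =
  (-1) ^+ t * \sum_(s : 'S_6) (-1) ^+ s * (Y1 (s (t #0)) (s (t #1)) *
     Y2 (s (t #2)) (s (t #3)) * Y3 (s (t #4)) (s (t #5))).
Proof.
rewrite /polpf (reindex_inj (mulgI t)) mulr_sumr; apply: eq_bigr => s _.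
by rewrite !permM odd_permM signr_addb mulrA.
Qed.

Lemma polpfC12 Y1 Y2 Y3 : polpf Y1 Y2 Y3 = polpf Y2 Y1 Y3.
Proof.
rewrite (polpf_reindex (tperm #0 #2 * tperm #1 #3)) odd_permM !odd_tperm /=.
rewrite expr0 mul1r; apply: eq_bigr => s _; congr (_ * _).
by rewrite !permM !permE /= [X in X * _ = _]mulrC.
Qed.

Lemma polpfC23 Y1 Y2 Y3 : polpf Y1 Y2 Y3 = polpf Y1 Y3 Y2.
Proof.
rewrite (polpf_reindex (tperm #2 #4 * tperm #3 #5)) odd_permM !odd_tperm /=.
rewrite expr0 mul1r; apply: eq_bigr => s _; congr (_ * _).
by rewrite !permM !permE /= mulrAC.
Qed.

Lemma polpf_tr Y1 Y2 Y3 : polpf Y1^T Y2 Y3 = - polpf Y1 Y2 Y3.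
Proof.
rewrite (polpf_reindex (tperm #0 #1)) odd_tperm /= expr1 mulN1r.
congr (- _); apply: eq_bigr => s _; congr (_ * _).
by rewrite !permE /= mxE.
Qed.

Lemma polpf_skew1 Y1 Y2 Y3 : polpf (skew_part Y1) Y2 Y3 = polpf Y1 Y2 Y3.
Proof.
have L := polpf_linear Y2 Y3; rewrite /skew_part.
have -> : 2^-1 *: (Y1 - Y1^T) = 2^-1 *: Y1 + ((- 2^-1) *: Y1^T + 0).
  by rewrite addr0 scalerBr scaleNr.
have L0 : polpf 0 Y2 Y3 = 0.
  by rewrite /polpf big1 // => s _; rewrite !mxE !mul0r mulr0.
rewrite !L L0 polpf_tr /GRing.scale /= addr0 mulrNN -mulrDl.
by rewrite -mulr2n -[_^-1 *+ 2]mulr_natr mulVf ?mul1r ?pnatr_eq0.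
Qed.

Lemma polpf_skew Y1 Y2 Y3 :
  polpf Y1 Y2 Y3 = polpf (skew_part Y1) (skew_part Y2) (skew_part Y3).
Proof.
have S2 A B D : polpf A (skew_part B) D = polpf A B D.
  by rewrite !(polpfC12 A) polpf_skew1.
have S3 A B D : polpf A B (skew_part D) = polpf A B D.
  by rewrite !(polpfC23 A B) S2.
by rewrite polpf_skew1 S2 S3.
Qed.

Lemma polpf_suml (F : 'I_6 -> 'M[C]_6) Y2 Y3 :
  polpf (\sum_p F p) Y2 Y3 = \sum_p polpf (F p) Y2 Y3.
Proof.
apply: (big_morph (fun Y => polpf Y Y2 Y3)) => [X Y|].
  by have := polpf_linear Y2 Y3 1 X Y; rewrite !scale1r.
by rewrite /polpf big1 // => s _; rewrite !mxE !mul0r mulr0.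
Qed.

Lemma polpf_sum (a b c a' b' c' : 'I_6 -> 'cV[C]_6) :
  polpf (\sum_p a p *m (a' p)^T) (\sum_q b q *m (b' q)^T)
    (\sum_r c r *m (c' r)^T) =
  \sum_p \sum_q \sum_r polpf (a p *m (a' p)^T) (b q *m (b' q)^T)
    (c r *m (c' r)^T).
Proof.
rewrite polpf_suml; apply: eq_bigr => p _.
rewrite polpfC12 polpf_suml; apply: eq_bigr => q _.
rewrite polpfC23 polpfC12 polpf_suml; apply: eq_bigr => r _.
by rewrite polpfC12 polpfC23 polpfC12.
Qed.

Lemma polpf_conj (g Y1 Y2 Y3 : 'M[C]_6) :
  polpf (g *m Y1 *m g^T) (g *m Y2 *m g^T) (g *m Y3 *m g^T) =
  \det g * polpf Y1 Y2 Y3.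
Proof.
have E (h Y : 'M[C]_6) : h *m Y *m h^T =
    \sum_p (h *m col p Y) *m (h *m delta_mx p (0 : 'I_1))^T.
  have {1}-> : Y = \sum_p col p Y *m delta_mx (0 : 'I_1) p.
    apply/matrixP => i j; rewrite summxE (bigD1 j) //= big1 => [|k kj].
      by rewrite !mxE big_ord1 !mxE !eqxx mulr1 addr0.
    by rewrite !mxE big_ord1 !mxE eqxx [j == k]eq_sym (negPf kj) mulr0.
  rewrite mulmx_sumr mulmx_suml; apply: eq_bigr => p _.
  by rewrite trmx_mul trmx_delta !mulmxA.
rewrite !E polpf_sum.
have {}E (Y : 'M[C]_6) : Y = \sum_p col p Y *m (delta_mx p (0 : 'I_1) : 'cV_6)^T.
  have := E 1%:M Y; rewrite trmx1 mul1mx mulmx1 => {1}->.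
  by apply: eq_bigr => p _; rewrite !mul1mx.
rewrite {2}(E Y1) {2}(E Y2) {2}(E Y3) polpf_sum.
rewrite mulr_sumr; apply: eq_bigr => p _.
rewrite mulr_sumr; apply: eq_bigr => q _.
rewrite mulr_sumr; apply: eq_bigr => r _.
pose u (j : 'I_6) : 'cV[C]_6 := nth 0 [:: col p Y1; delta_mx p 0; col q Y2;
  delta_mx q 0; col r Y3; delta_mx r 0] j.
have := polpf_rank1 u; rewrite /u /= => ->.
have := polpf_rank1 (fun j => g *m u j); rewrite /u /= => ->.
rewrite -det_mulmx; congr (\det _); apply/matrixP => i j; rewrite !mxE.
by apply: eq_bigr => k _; rewrite !mxE.
Qed.

Lemma polpf_diag Y : polpf Y Y Y = 48 * pfaffian6 (skew_part Y).
Proof.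
rewrite polpf_skew /pfaffian6 mulrA -natrX -natrM mulfV ?mul1r //.
by rewrite pnatr_eq0.
Qed.

Definition commutator (X Y : 'M[C]_6) : 'M[C]_6 := X *m Y - Y *m X.

Definition Q_fun (v : 'I_6 -> N) : C^o :=
  \sum_(s : 'S_6) (-1) ^+ s *
    polpf (commutator (v (s #0)) (v (s #1)))
          (commutator (v (s #2)) (v (s #3)))
          (commutator (v (s #4)) (v (s #5))).

Definition Q : form N C^o := homog Q_fun.

Lemma commutator_linear X : linear (commutator X).
Proof.
move=> a Y Z; rewrite /commutator !linearP /= mulmxDl -scalemxAl scalerBr.
by rewrite opprD addrACA.
Qed.

Lemma commutatorC X Y : commutator X Y = - commutator Y X.
Proof. by rewrite /commutator opprB. Qed.

Lemma commutator_linearl Y : linear (commutator^~ Y).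
Proof.
move=> a X Z; rewrite !(commutatorC _ Y) commutator_linear.
by rewrite opprD scalerN.
Qed.

Lemma Q_covariants : covariants (fun _ => id) Q.
Proof.
pose f (v : 'I_6 -> N) : C^o :=
  polpf (commutator (v #0) (v #1)) (commutator (v #2) (v #3))
        (commutator (v #4) (v #5)).
have P1 Y2 Y3 := polpf_linear Y2 Y3.
have P2 Y1 Y3 : linear (fun Y => polpf Y1 Y Y3 : C^o).
  by move=> a X Y; rewrite !(polpfC12 Y1) P1.
have P3 Y1 Y2 : linear (fun Y => polpf Y1 Y2 Y : C^o).
  by move=> a X Y; rewrite !(polpfC23 Y1 Y2) P2.
apply: homog_covariants => //.
- apply: (@multilinear_altsum _ _ _ 6 f) => v i a x y.
  case: i => [[|[|[|[|[|[|//]]]]]] ilt];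
    rewrite /f /upd -!val_eqE /= ?commutator_linear ?commutator_linearl;
    by rewrite ?P1 ?P2 ?P3.
- exact: (@alternating_altsum _ _ _ 6 f).
move=> [g hg] v; have /andP[/eqP gg /eqP dg] := hg.
have gU : g \in unitmx by case/mulmx1_unit: gg.
have gV : invmx g = g^T by rewrite -[RHS](mulKmx gU) gg mulmx1.
apply: eq_bigr => s _; congr (_ * _).
have E X Y : commutator (g *m X *m invmx g) (g *m Y *m invmx g) =
    g *m commutator X Y *m g^T.
  rewrite /commutator -gV mulmxBr mulmxBl !mulmxA.
  by rewrite !(mulmxKV gU).
by rewrite /= !E polpf_conj dg mul1r.
Qed.

End Invariants.

Arguments T1 : clear implicits.
Arguments Q : clear implicits.

(* Main.v *)
From HB Require Import structures.
From mathcomp Require Import all_boot all_order all_algebra all_fingroup.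
From mathcomp Require Import boolp classical_sets reals complex.
From mathcomp Require Import ring.
Require Import Defs.

Set Implicit Arguments.
Unset Strict Implicit.
Unset Printing Implicit Defensive.

Import Order.TTheory GRing.Theory Num.Theory.
Local Open Scope ring_scope.

(**
Write X for the generic element of the space N of traceless symmetric matrices
and E for the gradient of Q, the covariant of degree 5 defined by
tr(E(v_1, ..., v_5) Y) = Q(v_1, ..., v_5, Y).  Contracting Q /\ Q = 0 with Y
gives Q /\ E = 0.  If the covariants were free over A, generated by T_1 and Q,
then writing E = sum_j a_j /\ b_j in a basis would give Q /\ a_j = 0, so a_j
has no component of degree 0; its component of degree 5 is then a multiple of
T_1 and the lower ones vanish.  Hence E = sum_j c_j T_1 b_j(0), and b_j(0) = 0
because SO(6) fixes no nonzero element of N.  But E <> 0, as Q <> 0.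

Q /\ Q = 0 is the fact that pf(X^2)^2 = det(X^2) is a polynomial in the traces
tr(X^(2k)), which vanish since a cyclic rotation of an even number of odd
factors changes the sign.  In multilinear terms: the product of two pfaffian
monomials is a sum over 2-regular graphs, each of which has an automorphism
acting on the edges as an odd permutation.
*)

(** * Associativity of the wedge product *)

Section BlockPerm.
Variables (h k : nat).

Definition block_fun (s : 'S_h) (t : 'S_k) (i : 'I_(h + k)) : 'I_(h + k) :=
  match split i with inl j => lshift k (s j) | inr j => rshift h (t j) end.

Fact block_fun_inj s t : injective (block_fun s t).
Proof.
apply: (can_inj (g := block_fun s^-1%g t^-1%g)) => i.
rewrite /block_fun -{2}(splitK i); case: (split i) => j.
  by rewrite (unsplitK (inl _)) /= permK.
by rewrite (unsplitK (inr _)) /= permK.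
Qed.

Definition block_perm s t := perm (@block_fun_inj s t).

Lemma block_perm_lshift s t i : block_perm s t (lshift k i) = lshift k (s i).
Proof. by rewrite permE /block_fun (unsplitK (inl _)). Qed.

Lemma block_perm_rshift s t i : block_perm s t (rshift h i) = rshift h (t i).
Proof. by rewrite permE /block_fun (unsplitK (inr _)). Qed.

(** The permutation matrix is block diagonal with those of [s] and [t] as blocks; determinants then
    give the signs. *)
Lemma odd_block_perm s t : block_perm s t = s (+) t :> bool.
Proof.
have E : perm_mx (block_perm s t) =
    block_mx (perm_mx s) 0 0 (perm_mx t) :> 'M[int]_(h + k).
  apply/matrixP => i j; rewrite -(splitK i) -(splitK j).
  case: (split i) (split j) => [i'|i'] [j'|j'] /=;
    rewrite ?block_mxEul ?block_mxEur ?block_mxEdl ?block_mxEdr !mxE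
      ?block_perm_lshift ?block_perm_rshift.
  - by rewrite (inj_eq (@lshift_inj _ _)).
  - by rewrite eq_lrshift.
  - by rewrite eq_rlshift.
  - by rewrite (inj_eq (@rshift_inj _ _)).
have := congr1 determinant E.
rewrite det_ublock !det_perm -signr_addb.
by case: (odd_perm _) (_ (+) _) => [] [].
Qed.

End BlockPerm.

Section Wedge.
Variables (C : numFieldType) (N : lmodType C).

(** Extension by 0 to all of [nat]: slices of a tuple are then taken by shifting the index, without
    casts between ordinal types. *)
Definition pad m (v : 'I_m -> N) (n : nat) : N := oapp v 0 (insub n).

Lemma pad_ord m (v : 'I_m -> N) (i : 'I_m) : pad v i = v i.
Proof. by rewrite /pad valK. Qed.

Lemma pad_ge m (v : 'I_m -> N) n : (m <= n)%N -> pad v n = 0.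
Proof. by move=> le_mn; rewrite /pad insubF // ltnNge le_mn. Qed.

Section Values.
Variable V : lmodType C.
Implicit Types (F G : form N C^o) (H : form N V).

(** The sum of [wedge_homog] without its normalization. The type does not tie [m] to [h + k], which
    removes the [cast_ord] of [wedge]. *)
Definition shuffle_sum h k (f : ('I_h -> N) -> C^o) (g : ('I_k -> N) -> V) m
    (v : 'I_m -> N) : V :=
  \sum_(s : 'S_m) (-1) ^+ s *: ((f (fun i => pad (v \o s) i) : C) *:
     g (fun j => pad (v \o s) (h + j)%N)).

Lemma wedge_homogE h k m (e : (h + k)%N = m) (f : ('I_h -> N) -> C^o)
    (g : ('I_k -> N) -> V) (v : 'I_m -> N) :
  wedge_homog f g (fun i => v (cast_ord e i)) =
  (h`!%:R * k`!%:R)^-1 *: shuffle_sum f g v.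
Proof.
case: m / e v => v; rewrite /wedge_homog; congr (_ *: _).
apply: eq_bigr => s _; congr (_ *: (f _ *: g _)); apply/funext => i.
  by rewrite cast_ord_id -[RHS]/(pad (v \o s) (lshift k i)) pad_ord.
by rewrite cast_ord_id -[RHS]/(pad (v \o s) (rshift h i)) pad_ord.
Qed.

Lemma wedgeE F H m (v : 'I_m -> N) : wedge F H v =
  \sum_(h < m.+1) (h`!%:R * (m - h)`!%:R)^-1 *:
     shuffle_sum (F h) (H (m - h)%N) v.
Proof. by apply: eq_bigr => h _; rewrite wedge_homogE. Qed.

Lemma addformE (F1 F2 : form N V) k (v : 'I_k -> N) :
  (F1 + F2) k v = F1 k v + F2 k v.
Proof. by []. Qed.

Lemma wedgeDl F G H : wedge (F + G) H = wedge F H + wedge G H.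
Proof.
apply: formP => m v; rewrite addformE !wedgeE -big_split /=.
apply: eq_bigr => h _; rewrite -scalerDr -big_split /=; congr (_ *: _).
by apply: eq_bigr => s _; rewrite -scalerDr -scalerDl.
Qed.

Lemma wedgeDr F H1 H2 : wedge F (H1 + H2) = wedge F H1 + wedge F H2.
Proof.
apply: formP => m v; rewrite addformE !wedgeE -big_split /=.
apply: eq_bigr => h _; rewrite -scalerDr -big_split /=; congr (_ *: _).
by apply: eq_bigr => s _; rewrite -!scalerDr.
Qed.

Lemma wedge0l H : wedge 0 H = 0.
Proof. by apply: (addrI (wedge 0 H)); rewrite -wedgeDl !addr0. Qed.

Lemma wedge0r F : wedge F (0 : form N V) = 0.
Proof. by apply: (addrI (wedge F 0)); rewrite -wedgeDr !addr0. Qed.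

Lemma wedge_suml (I : Type) (r : seq I) (P : pred I) (F : I -> form N C^o) H :
  wedge (\sum_(i <- r | P i) F i) H = \sum_(i <- r | P i) wedge (F i) H.
Proof.
exact: (big_morph (fun G => wedge G H) (fun F G => wedgeDl F G H) (wedge0l H)).
Qed.

Lemma wedge_sumr (I : Type) (r : seq I) (P : pred I) F (H : I -> form N V) :
  wedge F (\sum_(i <- r | P i) H i) = \sum_(i <- r | P i) wedge F (H i).
Proof. exact: (big_morph (wedge F) (wedgeDr F) (wedge0r F)). Qed.

Lemma scaleCA (a b : C) (x : V) : a *: (b *: x) = b *: (a *: x).
Proof. by rewrite !scalerA mulrC. Qed.

Definition shuffle3 p q r (f : ('I_p -> N) -> C^o) (g : ('I_q -> N) -> C^o)
   (h : ('I_r -> N) -> V) m (v : 'I_m -> N) : V :=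
  \sum_(s : 'S_m) (-1) ^+ s *: ((f (fun i => pad (v \o s) i) : C) *:
    ((g (fun i => pad (v \o s) (p + i)%N) : C) *:
     h (fun j => pad (v \o s) (p + q + j)%N))).

Lemma sum_perm_const n (x : V) : \sum_(t : 'S_n) x = x *+ n`!.
Proof. by rewrite sumr_const card_Sn. Qed.

(** For each [t] of the inner sum, substituting [block_perm 1 t * s] for [s] absorbs [t] into the
    outer sum, so that [n!] equal copies remain. *)
Lemma shuffle_sumAr p q r (f : ('I_p -> N) -> C^o) (g : ('I_q -> N) -> C^o)
    (h : ('I_r -> N) -> V) n m (e : (p + n)%N = m) (v : 'I_m -> N) :
  shuffle_sum f (fun x : 'I_n -> N => shuffle_sum g h x) v =
  n`!%:R *: shuffle3 f g h v.
Proof.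
case: m / e v => v.
rewrite /shuffle_sum.
under eq_bigr do rewrite !scaler_sumr.
rewrite exchange_big /= scaler_nat -sum_perm_const; apply: eq_bigr => t _.
rewrite /shuffle3 [RHS](reindex_inj (mulgI (block_perm 1 t))) /=.
apply: eq_bigr => s _.
rewrite odd_permM odd_block_perm odd_perm1 addFb signr_addb mulrC -scalerA.
congr (_ *: _); rewrite [LHS]scaleCA; congr (_ *: _).
have E0 i : (i < p)%N -> pad (v \o (block_perm 1 t * s)%g) i = pad (v \o s) i.
  move=> ip; rewrite -[i in LHS]/(val (lshift n (Ordinal ip))).
  rewrite -[i in RHS]/(val (lshift n (Ordinal ip))) !pad_ord /=.
  by rewrite permM block_perm_lshift perm1.
have E1 i : pad (v \o (block_perm 1 t * s)%g) (p + i) =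
    pad ((fun j : 'I_n => pad (v \o s) (p + j)%N) \o t) i.
  rewrite {2}/pad; case: insubP => [j _ ji|ni] /=; last first.
    by rewrite pad_ge // leq_add2l leqNgt.
  rewrite -ji -[(p + j)%N]/(val (rshift p j)) pad_ord /=.
  by rewrite permM block_perm_rshift -[RHS]/(pad (v \o s) (rshift p (t j))) pad_ord.
congr (f _ *: (g _ *: h _)); apply/funext => i.
- by rewrite E0.
- by rewrite E1.
- by rewrite -!addnA E1.
Qed.

End Values.

Section Associativity.
Variable V : lmodType C.

(** The mirror image of [shuffle_sumAr]. With [p + q = n] the arguments of [f] and [g] lie in the
    block permuted by [t], and those of [h] start right after it. *)
Lemma shuffle_sumAl p q r (f : ('I_p -> N) -> C^o) (g : ('I_q -> N) -> C^o)
    (h : ('I_r -> N) -> V) n m (le_nm : (n <= m)%N) (e : (p + q)%N = n)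
    (v : 'I_m -> N) :
  shuffle_sum (fun x : 'I_n -> N => shuffle_sum f g x) h v =
  n`!%:R *: shuffle3 f g h v.
Proof.
have {le_nm} [k em] : {k | (n + k = m)%N} by exists (m - n)%N; rewrite subnKC.
case: m / em v => v; rewrite /shuffle_sum.
under eq_bigr do rewrite scaler_suml scaler_sumr.
rewrite exchange_big /= scaler_nat -sum_perm_const; apply: eq_bigr => t _.
rewrite /shuffle3 [RHS](reindex_inj (mulgI (block_perm t 1))) /=.
apply: eq_bigr => s _.
rewrite odd_permM odd_block_perm odd_perm1 addbF signr_addb mulrC -!scalerA.
congr (_ *: (_ *: _)).
have E0 i : (i < n)%N -> pad (v \o (block_perm t 1 * s)%g) i =
    pad ((fun j : 'I_n => pad (v \o s) j) \o t) i.
  move=> ip; rewrite -[i in LHS]/(val (lshift k (Ordinal ip))).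
  rewrite -[i in RHS]/(val (Ordinal ip)) !pad_ord /=.
  rewrite permM block_perm_lshift.
  by rewrite -[RHS]/(pad (v \o s) (lshift k (t (Ordinal ip)))) pad_ord.
have E1 i : pad (v \o (block_perm t 1 * s)%g) (n + i) = pad (v \o s) (n + i).
  have [lt_i|le_i] := ltnP i k; last first.
    by rewrite !pad_ge ?leq_add2l.
  rewrite -[(n + i)%N]/(val (rshift n (Ordinal lt_i))) !pad_ord /=.
  by rewrite permM block_perm_rshift perm1.
congr (f _ *: (g _ *: h _)); apply/funext => i.
- by rewrite E0 // -e ltn_addr.
- by rewrite E0 // -e ltn_add2l.
- by rewrite e E1.
Qed.

End Associativity.

(** Both sides run over the triples of sum [m]; on the left, [n] is the sum of the first two
    entries. *)
Lemma sum_triangle (V : zmodType) (f : nat -> nat -> nat -> V) m :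
  \sum_(n < m.+1) \sum_(p < n.+1) f p (n - p)%N (m - n)%N =
  \sum_(p < m.+1) \sum_(q < (m - p).+1) f p q (m - p - q)%N.
Proof.
transitivity (\sum_(n < m.+1) \sum_(p < m.+1 | (p <= n)%N)
    f p (n - p)%N (m - n)%N).
  apply: eq_bigr => n _.
  rewrite (big_ord_widen_cond m.+1 xpredT (fun p => f p (n - p)%N (m - n)%N)) //.
rewrite (exchange_big_dep xpredT) //=; apply: eq_bigr => p _.
rewrite (big_ord_widen_cond m.+1 xpredT (fun q => f p q (m - p - q)%N));
  last by rewrite ltnS leq_subr.
rewrite -(big_mkord (fun n => p <= n)%N (fun n => f p (n - p)%N (m - n)%N)).
rewrite -(big_mkord (fun q => q < (m - p).+1)%N (fun q => f p q (m - p - q)%N)).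
rewrite (big_cat_nat (n := p)) //=; last by rewrite ltnW.
rewrite big_nat_cond big1 ?add0r; last first.
  by move=> i /andP[/andP[_ ip]]; rewrite leqNgt ip.
rewrite [RHS](big_cat_nat (n := (m - p).+1)) //=; last by rewrite ltnS leq_subr.
rewrite [X in _ = _ + X]big_nat_cond [X in _ = _ + X]big1 ?addr0; last first.
  by move=> i /andP[/andP[pi _]]; rewrite ltnNge pi.
rewrite -{1}[nat_of_ord p]add0n big_addn subSn ?leq_ord //.
rewrite big_nat_cond [RHS]big_nat_cond; apply: eq_big => [i|i].
  by rewrite leq_addl andbT; apply/idP/idP => [/andP[-> ->]|/andP[->]].
by move=> _; rewrite addnK addnC subnDA.
Qed.

Lemma wedgeA (V : lmodType C) (F G : form N C^o) (H : form N V) :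
  wedge F (wedge G H) = wedge (wedge F G) H.
Proof.
apply: formP => m v; rewrite !wedgeE.
(* Both bracketings reduce to the sum of these terms: the factorial produced by merging the two sums
   over permutations cancels that of the degree of the inner product. *)
pose f p q r : V := (p`!%:R * q`!%:R * r`!%:R)^-1 *: shuffle3 (F p) (G q) (H r) v.
have fact_neq0 n : n`!%:R != 0 :> C by rewrite pnatr_eq0 -lt0n fact_gt0.
transitivity (\sum_(p < m.+1) \sum_(q < (m - p).+1) f p q (m - p - q)%N).
  apply: eq_bigr => p _.
  have -> : wedge G H (k := (m - p)%N) = fun x => \sum_(q < (m - p).+1)
     (q`!%:R * (m - p - q)`!%:R)^-1 *:
       shuffle_sum (G q) (H (m - p - q)%N) x.
    by apply/funext => x; rewrite wedgeE.
  transitivity ((p`!%:R * (m - p)`!%:R)^-1 *: (\sum_(q < (m - p).+1)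
    (q`!%:R * (m - p - q)`!%:R)^-1 *: shuffle_sum (F p)
       (fun x : 'I_(m - p) -> N => shuffle_sum (G q) (H (m - p - q)%N) x) v)).
    congr (_ *: _); rewrite /shuffle_sum.
    under [RHS]eq_bigr do rewrite scaler_sumr.
    rewrite exchange_big /=; apply: eq_bigr => s _.
    rewrite !scaler_sumr; apply: eq_bigr => q _.
    by rewrite [X in _ *: X = _]scaleCA [LHS]scaleCA.
  rewrite scaler_sumr; apply: eq_bigr => q _.
  rewrite shuffle_sumAr ?subnKC ?leq_ord // !scalerA /f; congr (_ *: _).
  rewrite !invfM -!mulrA; congr (_ * _).
  by rewrite mulrCA; congr (_ * _); rewrite mulrCA mulVf ?mulr1.
rewrite -sum_triangle; apply: eq_bigr => n _.
have -> : wedge F G (k := n) = fun x => \sum_(p < n.+1)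
   (p`!%:R * (n - p)`!%:R)^-1 *: shuffle_sum (F p) (G (n - p)%N) x.
  by apply/funext => x; rewrite wedgeE.
transitivity ((n`!%:R * (m - n)`!%:R)^-1 *: (\sum_(p < n.+1)
  (p`!%:R * (n - p)`!%:R)^-1 *: shuffle_sum (fun x : 'I_n -> N =>
      shuffle_sum (F p) (G (n - p)%N) x) (H (m - n)%N) v)); last first.
  congr (_ *: _); rewrite /shuffle_sum.
  under eq_bigr do rewrite scaler_sumr.
  rewrite exchange_big /=; apply: eq_bigr => s _.
  rewrite scaler_suml scaler_sumr; apply: eq_bigr => q _.
  by rewrite scaleCA [X in _ *: X]scalerA.
rewrite scaler_sumr; apply: eq_bigr => p _.
rewrite shuffle_sumAl ?leq_ord ?subnKC ?leq_ord // !scalerA /f; congr (_ *: _).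
rewrite [RHS]mulrAC [(n`!%:R * _)^-1]invfM [X in X / (_ * _)]mulrAC mulVf // mul1r.
by rewrite -invfM mulrC.
Qed.

End Wedge.

(** * Alternating sums over graphs *)

(** Products of transpositions are encoded as lists of pairs of numbers so that [vm_compute] can
    evaluate them. The pairs act from left to right, as in a product of permutations. *)
Definition swap_nat (ts : seq (nat * nat)) (x : nat) : nat :=
  foldl (fun x t => if x == t.1 then t.2 else if x == t.2 then t.1 else x) x ts.

Definition swap_perm n (ts : seq (nat * nat)) : 'S_n.+1 :=
  (\prod_(t <- ts) tperm (inord t.1) (inord t.2))%g.

Definition proper_swap n (t : nat * nat) := [&& t.1 < n, t.2 < n & t.1 != t.2]%N.

Lemma swap_permE n ts (x : 'I_n.+1) : all (proper_swap n.+1) ts ->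
  swap_perm n ts x = swap_nat ts x :> nat.
Proof.
rewrite /swap_perm; elim: ts x => [|[a b] ts IH] x /=.
  by rewrite big_nil perm1.
case/andP=> /and3P[/= an bn _] /IH {}IH; rewrite big_cons permM IH /=.
congr (swap_nat ts _); rewrite -[X in X == a](inordK (ltn_ord x)).
by case: tpermP => [->|->|/eqP + /eqP]; rewrite ?inordK ?eqxx //;
  [case: eqP|rewrite -!val_eqE /= !inordK // => /negPf -> /negPf ->].
Qed.

Lemma odd_swap_perm n ts : all (proper_swap n.+1) ts ->
  swap_perm n ts = odd (size ts) :> bool.
Proof.
rewrite /swap_perm; elim: ts => [|[a b] ts IH] /=; first by rewrite big_nil odd_perm1.
case/andP=> /and3P[/= an bn ab] /IH {}IH; rewrite big_cons odd_permM IH odd_tperm.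
by rewrite -val_eqE /= !inordK // ab addTb.
Qed.

Lemma sum_ffun_split (R : nmodType) (T : finType) a b
    (F : {ffun 'I_(a + b) -> T} -> R) :
  \sum_L F L = \sum_(f : {ffun 'I_a -> T}) \sum_(g : {ffun 'I_b -> T})
    F [ffun x => match split x with inl i => f i | inr j => g j end].
Proof.
rewrite pair_big /= (reindex (fun p : {ffun 'I_a -> T} * {ffun 'I_b -> T} =>
  [ffun x => match split x with inl i => p.1 i | inr j => p.2 j end])) //=.
exists (fun L : {ffun 'I_(a + b) -> T} =>
  ([ffun i => L (lshift b i)], [ffun j => L (rshift a j)])) => [[f g] _|L _] /=.
  congr (_, _); apply/ffunP => i; rewrite !ffunE.
    by rewrite (unsplitK (inl _)).
  by rewrite (unsplitK (inr _)).
by apply/ffunP => x; rewrite ffunE -{2}(splitK x); case: split => i; rewrite ffunE.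
Qed.

Section AltGraph.
Variables (C : numFieldType) (n k : nat) (W : finType).

(* Reindexing by an odd edge permutation that comes from a graph automorphism *)
(* changes the sign of the alternating sum.                                   *)
Lemma alt_graph_sum0 (src tgt : 'I_k -> W) (c : 'S_k) (d : {perm W})
    (v : 'I_k -> 'M[C]_n) :
  odd_perm c -> (forall e, (v e)^T = v e) ->
  (forall e, (src (c e), tgt (c e)) = (d (src e), d (tgt e)) \/
     (src (c e), tgt (c e)) = (d (tgt e), d (src e))) ->
  \sum_(s : 'S_k) (-1) ^+ s * \sum_(L : {ffun W -> 'I_n})
     \prod_e v (s e) (L (src e)) (L (tgt e)) = 0.
Proof.
move=> c_odd v_sym auto_cd.
pose T (s : 'S_k) := \sum_(L : {ffun W -> 'I_n})
   \prod_e v (s e) (L (src e)) (L (tgt e)).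
(* Labels are moved along [d] and factors along [c]; a reversed edge keeps its factor because the
   matrices are symmetric. *)
have Tc s : T (c * s)%g = T s.
  rewrite [RHS](reindex_inj (h := fun L : {ffun W -> 'I_n} =>
    [ffun x => L (d^-1%g x)])) /=; last first.
    move=> L1 L2 /ffunP eL; apply/ffunP => x.
    by have := eL (d x); rewrite !ffunE permK.
  apply: eq_bigr => L _; rewrite [RHS](reindex_inj (@perm_inj _ c)) /=.
  apply: eq_bigr => e _; rewrite permM !ffunE.
  case: (auto_cd e) => [[-> ->]|[-> ->]]; rewrite !permK //.
  by rewrite -{1}v_sym mxE.
set S := LHS; have : S = - S.
  rewrite {1}/S (reindex_inj (mulgI c)) -sumrN /=; apply: eq_bigr => s _.
  by rewrite odd_permM c_odd addTb signrN mulNr -/(T s) -(Tc s).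
by move/eqP; rewrite -addr_eq0 -mulr2n mulrn_eq0 /= => /eqP.
Qed.

End AltGraph.

(* In the product of two pfaffian monomials in X_0 X_1, ..., X_10 X_11, the   *)
(* edge e is the factor X_e.  One of its indices, the mid end, is contracted  *)
(* in the product X_(2k) X_(2k+1); the other, the glue end, is one of the     *)
(* permuted indices of its pfaffian, those of the second pfaffian being       *)
(* matched with those of the first by rho, listed as r.  Every cycle of this  *)
(* graph alternates between glue and mid vertices and has length 4j, so that  *)
(* its reflection fixing one edge exchanges 2j - 1 pairs of edges.            *)
Section PfaffianGraph.
Implicit Types r : seq nat.

Definition glue_end r (e : nat) := if (e < 6)%N then e else nth 0%N r (e - 6).
Definition mid_end (e : nat) := (6 + e./2)%N.
Definition glue_mate r (e : nat) :=
  if (e < 6)%N then (6 + index e r)%N else nth 0%N r (e - 6).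
Definition mid_mate (e : nat) := if odd e then e.-1 else e.+1.

(** Follows a cycle in both directions at once, [x] leaving the starting edge through its mid end
    and [y] through its glue end. The two lists are the pairs of edges and of vertices to exchange;
    the walk stops at the opposite edge, which is fixed. *)
Fixpoint reflection_walk r fuel (at_mid : bool) (x y : nat) :
    seq (nat * nat) * seq (nat * nat) :=
  if fuel is fuel'.+1 then
    let x' := if at_mid then mid_mate x else glue_mate r x in
    let y' := if at_mid then glue_mate r y else mid_mate y in
    if x' == y' then ([::], [::]) else
    let cd := reflection_walk r fuel' (~~ at_mid) x' y' in
    ((x', y') :: cd.1,
     (if at_mid then (glue_end r x', mid_end y')
      else (mid_end x', glue_end r y')) :: cd.2)
  else ([::], [::]).

Definition reflection r :=
  let cd := reflection_walk r 12 true 0 0 in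
  (cd.1, (mid_end 0, glue_end r 0) :: cd.2).

Definition odd_automorphism r (cd : seq (nat * nat) * seq (nat * nat)) :=
  [&& all (proper_swap 12) cd.1, all (proper_swap 12) cd.2, odd (size cd.1)
    & all (fun e => let x := glue_end r (swap_nat cd.1 e) in
         let y := mid_end (swap_nat cd.1 e) in
         let x' := swap_nat cd.2 (glue_end r e) in
         let y' := swap_nat cd.2 (mid_end e) in
         ((x == x') && (y == y')) || ((x == y') && (y == x'))) (iota 0 12)].

(** A direct check of all 720 matchings, in place of a proof by cycle lengths. *)
Lemma reflection_odd_automorphism :
  all (fun r => odd_automorphism r (reflection r)) (permutations (iota 0 6)).
Proof. by vm_compute. Qed.

Definition half6 (e : 'I_6) : 'I_3 := inord e./2.

Lemma half6E e : half6 e = e./2 :> nat.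
Proof. by rewrite inordK // ltn_half_double. Qed.

Definition glue_vertex (rho : 'S_6) (e : 'I_(6 + 6)) : 'I_(6 + (3 + 3)) :=
  lshift _ (match split e with inl i => i | inr i => rho i end).

Definition mid_vertex (e : 'I_(6 + 6)) : 'I_(6 + (3 + 3)) :=
  rshift 6 (match split e with
            | inl i => lshift 3 (half6 i) | inr i => rshift 3 (half6 i) end).

Lemma odd_automorphism_exists (rho : 'S_6) : exists (c d : 'S_12),
  odd_perm c /\ forall e,
   (glue_vertex rho (c e), mid_vertex (c e)) =
     (d (glue_vertex rho e), d (mid_vertex e)) \/
   (glue_vertex rho (c e), mid_vertex (c e)) =
     (d (mid_vertex e), d (glue_vertex rho e)).
Proof.
pose r := [seq val (rho i) | i : 'I_6].
have r_perm : r \in permutations (iota 0 6).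
  rewrite mem_permutations; apply: uniq_perm.
  - by rewrite map_inj_uniq ?enum_uniq // => i j /val_inj /perm_inj.
  - exact: iota_uniq.
  move=> i; rewrite mem_iota /= add0n; apply/mapP/idP => [[j _ ->]|i6]; first exact: ltn_ord.
  by exists (rho^-1%g (Ordinal i6)); rewrite ?mem_enum ?permKV.
have /allP auts := reflection_odd_automorphism.
move: (auts r r_perm) => {auts}.
move: (reflection r) => [cs ds]; rewrite /odd_automorphism.
move=> /and4P[c_proper d_proper c_odd ends_all].
have glueE (e : 'I_12) : glue_end r e = glue_vertex rho e.
  rewrite /glue_end /glue_vertex /=; case: splitP => i ei; rewrite ei ?ltn_ord //.
  by rewrite addKn (nth_map i) ?size_enum_ord // nth_ord_enum.
have midE (e : 'I_12) : mid_end e = mid_vertex e.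
  rewrite /mid_end /mid_vertex /=; case: splitP => i; rewrite /= half6E => ->.
    by [].
  by case: i => [[|[|[|[|[|[|//]]]]]] ?].
exists (swap_perm 11 cs), (swap_perm 11 ds); split.
  by rewrite odd_swap_perm.
move=> e; have /(allP ends_all) : val e \in iota 0 12.
  by rewrite mem_iota leq0n add0n ltn_ord.
rewrite -!swap_permE // !glueE !midE -!swap_permE //.
by case/orP=> /andP[/eqP/val_inj -> /eqP/val_inj ->]; [left|right].
Qed.

End PfaffianGraph.

(* As in the proof of the multiplicativity of determinants, the terms that    *)
(* extend the sum from permutations to all functions cancel.                  *)
Lemma mul_altsum (R : numFieldType) n (h1 h2 : {ffun 'I_n -> 'I_n} -> R) :
  (\sum_(t : 'S_n) (-1) ^+ t * h1 (pval t)) *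
    (\sum_(u : 'S_n) (-1) ^+ u * h2 (pval u)) =
  \sum_(rho : 'S_n) (-1) ^+ rho *
    \sum_i h1 i * h2 [ffun x => i (rho x)].
Proof.
under [RHS]eq_bigr do rewrite mulr_sumr.
rewrite exchange_big /=.
rewrite [RHS](bigID (fun i : {ffun 'I_n -> 'I_n} => injectiveb i)) /=.
rewrite [X in _ = _ + X]big1 ?addr0 => [|i].
  rewrite [RHS](reindex (@pval _)) /=; last first.
    pose in_Sn := insubd (1%g : 'S_n).
    by exists in_Sn => /= f Uf; first apply: val_inj; apply: insubdK.
  rewrite mulr_suml; apply: eq_big => /= [t|t _]; rewrite ?(valP t) //.
  (* With [u = rho * t] the two signs of [t] cancel and that of [rho] remains. *)
  rewrite [LHS]mulr_sumr (reindex_inj (mulIg t)) /=; apply: eq_bigr => rho _.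
  rewrite odd_permM signr_addb mulrACA [(-1) ^+ t * _]mulrCA.
  rewrite -signr_addb addbb mulr1.
  congr (_ * (_ * h2 _)); apply/ffunP => x.
  by rewrite ffunE !pvalE permM.
case/injectivePn => a [b ab iab].
set S := LHS; have : S = - S.
  rewrite {1}/S (reindex_inj (mulIg (tperm a b))) -sumrN /=.
  apply: eq_bigr => rho _; rewrite odd_permM odd_tperm ab addbT signrN mulNr.
  congr (- (_ * (_ * h2 _))); apply/ffunP => x; rewrite !ffunE permM.
  by case: tpermP => [->|->|].
by move/eqP; rewrite -addr_eq0 -mulr2n mulrn_eq0 /= => /eqP.
Qed.

Section PfaffianSquare.
Variable C : numFieldType.
Local Notation "# k" := (@Ordinal 6 k isT) (at level 2, format "# k").

Definition pf_monomial (w : 'I_6 -> 'M[C]_6) : C :=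
  polpf (w #0 *m w #1) (w #2 *m w #3) (w #4 *m w #5).

Definition path_sum (w : 'I_6 -> 'M[C]_6) (i : {ffun 'I_6 -> 'I_6}) : C :=
  \sum_(m : {ffun 'I_3 -> 'I_6}) \prod_(e < 6) w e (i e) (m (half6 e)).

(** Each of the three matrix products is expanded over its contracted index. Symmetry of the second
    factor puts the glue index first in all six entries. *)
Lemma pf_monomialE w : (forall e, (w e)^T = w e) ->
  pf_monomial w = \sum_(t : 'S_6) (-1) ^+ t * path_sum w (pval t).
Proof.
move=> w_sym; apply: eq_bigr => t _; congr (_ * _).
pose F (k : 'I_3) (j : 'I_6) := nth 0 [::
  w #0 (t #0) j * w #1 (t #1) j; w #2 (t #2) j * w #3 (t #3) j;
  w #4 (t #4) j * w #5 (t #5) j] k.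
transitivity (\prod_k \sum_j F k j).
  have -> (S : 'I_3 -> C) : \prod_k S k =
      S ord0 * S (lift ord0 ord0) * S (lift ord0 (lift ord0 ord0)).
    by rewrite !big_ord_recl big_ord0 mulr1 mulrA.
  rewrite !mxE /F /=.
  congr (_ * _ * _); apply: eq_bigr => j _; congr (_ * _);
    by rewrite -[in LHS]w_sym mxE.
rewrite bigA_distr_bigA /=; apply: eq_bigr => m _.
have ordE (i : 'I_6) k (h : (k < 6)%N) : i = k :> nat -> i = Ordinal h.
  by move=> ik; apply: val_inj.
rewrite !big_ord_recl !big_ord0 !mulr1 /F /=.
rewrite (ordE ord0 0%N isT) // (ordE (lift _ _) 1%N isT) //.
rewrite (ordE (lift _ (lift _ _)) 2%N isT) //.
rewrite (ordE (lift _ (lift _ (lift _ _))) 3%N isT) //.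
rewrite (ordE (lift _ (lift _ (lift _ (lift _ _)))) 4%N isT) //.
rewrite (ordE (lift _ (lift _ (lift _ (lift _ (lift _ _))))) 5%N isT) //.
have halfE k (h : (k < 6)%N) (i : 'I_3) : k./2 = i -> half6 (Ordinal h) = i.
  by move=> ki; apply: val_inj; rewrite /= half6E.
rewrite (halfE 0 _ ord0) // (halfE 1 _ ord0) //.
rewrite (halfE 2 _ (lift ord0 ord0)) // (halfE 3 _ (lift ord0 ord0)) //.
rewrite (halfE 4 _ (lift ord0 (lift ord0 ord0))) //.
rewrite (halfE 5 _ (lift ord0 (lift ord0 ord0))) //.
by rewrite !pvalE !mulrA.
Qed.

(** By [mul_altsum] the product is a signed sum over matchings [rho]; each one gives a sum over a
    single graph, killed by its odd automorphism. *)
Lemma pf_monomial_altsum0 (v : 'I_(6 + 6) -> 'M[C]_6) :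
  (forall e, (v e)^T = v e) ->
  \sum_(s : 'S_(6 + 6)) (-1) ^+ s * (pf_monomial (fun i => v (s (lshift 6 i))) *
     pf_monomial (fun i => v (s (rshift 6 i)))) = 0.
Proof.
move=> v_sym.
under eq_bigr do rewrite !pf_monomialE // mul_altsum mulr_sumr.
rewrite exchange_big big1 //= => rho _.
under eq_bigr do rewrite mulrCA.
rewrite -mulr_sumr; apply/eqP; rewrite mulf_eq0; apply/orP; right; apply/eqP.
have [c [d [c_odd auto_cd]]] := odd_automorphism_exists rho.
rewrite -[RHS](alt_graph_sum0 c_odd v_sym auto_cd).
apply: eq_bigr => s _; congr (_ * _).
rewrite sum_ffun_split; apply: eq_bigr => i _.
rewrite sum_ffun_split /path_sum mulr_suml; apply: eq_bigr => m _.
rewrite mulr_sumr; apply: eq_bigr => m' _.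
rewrite [RHS](@big_split_ord _ _ _ 6 6) /=; congr (_ * _); apply: eq_bigr => e _.
  rewrite !ffunE /glue_vertex /mid_vertex (unsplitK (inl e)).
  rewrite (unsplitK (inl e)) (unsplitK (inr (lshift 3 (half6 e)))).
  by rewrite ffunE (unsplitK (inl (half6 e))).
rewrite !ffunE /glue_vertex /mid_vertex (unsplitK (inr e)).
rewrite (unsplitK (inl (rho e))) (unsplitK (inr (rshift 3 (half6 e)))).
by rewrite ffunE (unsplitK (inr (half6 e))).
Qed.
End PfaffianSquare.

(** * The square of Q *)

Section AltSum.
Variables (C : numFieldType) (N V : lmodType C) (k : nat).

Definition altsum (f : ('I_k -> N) -> V) (v : 'I_k -> N) : V :=
  \sum_(s : 'S_k) (-1) ^+ s *: f (fun i => v (s i)).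

Lemma altsum_perm f v (t : 'S_k) :
  altsum f (fun i => v (t i)) = (-1) ^+ t *: altsum f v.
Proof.
rewrite scaler_sumr [RHS](reindex_inj (mulIg t)); apply: eq_bigr => s _ /=.
rewrite scalerA odd_permM signr_addb mulrCA -signr_addb addbb mulr1.
by congr (_ *: f _); apply/funext => i; rewrite permM.
Qed.

End AltSum.

Section Snoc.
Variables (C : numFieldType) (N : lmodType C) (k : nat).

Definition snoc (v : 'I_k -> N) (y : N) (i : 'I_k.+1) : N :=
  if (i < k)%N then pad v i else y.

Lemma snoc_lift v y i : snoc v y (lift ord_max i) = v i.
Proof. by rewrite /snoc lift_max ltn_ord pad_ord. Qed.

Lemma snoc_max v y : snoc v y ord_max = y.
Proof. by rewrite /snoc ltnn. Qed.

End Snoc.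

Section QSquare.
Variable C : numFieldType.
Local Notation N := (symtl C 6).
Local Notation "# k" := (@Ordinal 6 k isT) (at level 2, format "# k").

Lemma symtl_sym (X : N) : (val X)^T = val X.
Proof. by case: X => X /= /andP[/eqP]. Qed.

(** For symmetric X and Y the commutator is XY minus its transpose, and [polpf] is odd under
    transposition: each argument contributes a factor 2. *)
Lemma polpf_commutator (v : 'I_6 -> N) :
  polpf (commutator (v #0) (v #1)) (commutator (v #2) (v #3))
    (commutator (v #4) (v #5)) = 8 * pf_monomial (fun i => val (v i)).
Proof.
have P1 (X Y : N) A B : polpf (commutator X Y) A B =
    2 * polpf (val X *m val Y) A B.
  have -> : commutator X Y = (-1) *: (val X *m val Y)^T + (val X *m val Y).
    by rewrite trmx_mul !symtl_sym scaleN1r addrC.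
  rewrite polpf_linear polpf_tr -[(-1) *: _]/(-1 * _).
  by rewrite mulrNN mul1r mulr_natl.
rewrite P1 polpfC12 P1 polpfC23 polpfC12 P1 !mulrA -!natrM.
by rewrite polpfC12 polpfC23 polpfC12.
Qed.

Lemma Q_funE (v : 'I_6 -> N) :
  Q_fun v = 8 * \sum_(s : 'S_6) (-1) ^+ s * pf_monomial (fun i => val (v (s i))).
Proof.
rewrite mulr_sumr; apply: eq_bigr => s _.
by rewrite (polpf_commutator (fun i => v (s i))) mulrCA.
Qed.

Lemma Q_fun_perm (v : 'I_6 -> N) (t : 'S_6) :
  Q_fun (fun i => v (t i)) = (-1) ^+ t * Q_fun v.
Proof.
exact: (altsum_perm (fun w : 'I_6 -> N => polpf (commutator (w #0) (w #1))
  (commutator (w #2) (w #3)) (commutator (w #4) (w #5)) : C^o)).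
Qed.

Definition Q_pair (u : 'I_(6 + 6) -> N) : C :=
  Q_fun (fun i => u (lshift 6 i)) * Q_fun (fun i => u (rshift 6 i)).

(** After both factors are expanded, the inner permutations [t] and [t'] are absorbed into [s] by
    [block_perm], and every pair leaves the sum of [pf_monomial_altsum0]. *)
Lemma Q_pair_altsum0 (v : 'I_(6 + 6) -> N) :
  \sum_(s : 'S_(6 + 6)) (-1) ^+ s * Q_pair (fun i => v (s i)) = 0.
Proof.
pose g (w : 'I_6 -> N) : C := pf_monomial (fun i => val (w i)).
pose F (s : 'S_(6 + 6)) (t t' : 'S_6) :=
  8 * 8 * ((-1) ^+ s * (((-1) ^+ t * g (fun i => v (s (lshift 6 (t i))))) *
    ((-1) ^+ t' * g (fun i => v (s (rshift 6 (t' i))))))).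
transitivity (\sum_s \sum_t \sum_t' F s t t').
  apply: eq_bigr => s _; rewrite /Q_pair !Q_funE mulrACA [LHS]mulrCA big_distrlr /=.
  rewrite !mulr_sumr; apply: eq_bigr => t _.
  by rewrite [X in _ * X]mulr_sumr [LHS]mulr_sumr.
rewrite exchange_big big1 //= => t _; rewrite exchange_big big1 //= => t' _.
rewrite -mulr_sumr; apply/eqP; rewrite mulf_eq0; apply/orP; right; apply/eqP.
have := @pf_monomial_altsum0 _ (fun i => val (v i)) (fun i => symtl_sym (v i)).
rewrite (reindex_inj (mulgI (block_perm t t'))) /= => E; rewrite -[RHS]E.
apply: eq_bigr => s _.
rewrite odd_permM odd_block_perm !signr_addb [X in _ * X = _]mulrACA.
rewrite [LHS]mulrCA [LHS]mulrA.
congr (_ * (pf_monomial _ * pf_monomial _)); apply/funext => i; rewrite permM.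
  by rewrite block_perm_lshift.
by rewrite block_perm_rshift.
Qed.

(* All the terms of the alternating sum are thereby reduced to those in which *)
(* the last vector stays in place, which gives the contraction of Q /\ Q.     *)
Lemma Q_pair_move_last (p : 'I_(6 + 6)) : exists c : 'S_(6 + 6),
  c p = ord_max /\
  forall u, (-1) ^+ c * Q_pair (fun i => u (c i)) = Q_pair u.
Proof.
pose last6 : 'I_6 := ord_max.
have lastE : rshift 6 last6 = ord_max :> 'I_(6 + 6) by apply: val_inj.
have case_r (j : 'I_6) : exists c : 'S_(6 + 6), c (rshift 6 j) = ord_max /\
    forall u, (-1) ^+ c * Q_pair (fun i => u (c i)) = Q_pair u.
  exists (block_perm 1 (tperm j last6)); split.
    by rewrite block_perm_rshift tpermL lastE.
  move=> u; rewrite odd_block_perm odd_perm1 addFb /Q_pair.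
  transitivity ((-1) ^+ tperm j last6 * (Q_fun (fun i => u (lshift 6 i)) *
      Q_fun (fun i => u (rshift 6 (tperm j last6 i))))).
    congr (_ * (Q_fun _ * Q_fun _)); apply/funext => i.
      by rewrite block_perm_lshift perm1.
    by rewrite block_perm_rshift.
  rewrite (Q_fun_perm (fun i => u (rshift 6 i))) mulrCA [X in _ * X]mulrA.
  by rewrite -signr_addb addbb mul1r.
rewrite -(splitK p); case: (split p) => j; last exact: case_r.
pose ts := [seq (i, 6 + i)%N | i <- iota 0 6].
pose swap : 'S_(6 + 6) := swap_perm 11 ts.
have swap_l i : swap (lshift 6 i) = rshift 6 i.
  apply: val_inj; rewrite /= swap_permE //.
  by case: i => [[|[|[|[|[|[|//]]]]]] ?].
have swap_r i : swap (rshift 6 i) = lshift 6 i.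
  apply: val_inj; rewrite /= swap_permE //.
  by case: i => [[|[|[|[|[|[|//]]]]]] ?].
have [c [cj cQ]] := case_r j.
exists (swap * c)%g; split; first by rewrite permM swap_l cj.
move=> u; rewrite odd_permM odd_swap_perm // addFb -[RHS]cQ; congr (_ * _).
rewrite /Q_pair mulrC; congr (Q_fun _ * Q_fun _); apply/funext => i.
  by rewrite permM swap_r.
by rewrite permM swap_l.
Qed.

Lemma sum_lift_perm_max (R : nmodType) n (F : 'S_n.+1 -> R) :
  \sum_(s : 'S_n.+1 | s ord_max == ord_max) F s =
  \sum_(s : 'S_n) F (lift_perm ord_max ord_max s).
Proof.
pose low (s : 'S_n.+1) k := odflt k (unlift ord_max (s (lift ord_max k))).
have lowE (s : 'S_n.+1) k : s ord_max = ord_max ->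
    lift ord_max (low s k) = s (lift ord_max k).
  move=> smax; rewrite /low; have := neq_lift ord_max k.
  by rewrite -(inj_eq (@perm_inj _ s)) smax => /unlift_some[] ? ? ->.
have low_inj (s : 'S_n.+1) : s ord_max == ord_max -> injective (low s).
  move=> /eqP smax i j /(congr1 (lift ord_max)); rewrite !lowE //.
  by move/perm_inj/lift_inj.
(* The inverse of lifting; the value 1 on permutations that move the last point is a mere
   default. *)
pose unlift_perm (s : 'S_n.+1) : 'S_n :=
  if @idP (s ord_max == ord_max) is ReflectT h then perm (low_inj s h) else 1%g.
rewrite (reindex (lift_perm ord_max ord_max)).
  by apply: eq_bigl => s; rewrite lift_perm_id eqxx.
exists unlift_perm => s; rewrite /unlift_perm.
  move=> _; case: {-}_ / idP => [h|]; last by rewrite lift_perm_id eqxx.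
  apply/permP => i; apply: (@lift_inj _ ord_max).
  by rewrite permE lowE ?lift_perm_lift ?lift_perm_id.
rewrite inE => smax; case: {-}_ / idP => [h|//]; apply/permP => i.
case: (unliftP ord_max i) => [i'|] ->.
  by rewrite lift_perm_lift permE lowE // (eqP smax).
by rewrite lift_perm_id (eqP smax).
Qed.

Lemma Q_wedge_gradient0 (v : 'I_11 -> N) (y : N) :
  \sum_(s : 'S_11) (-1) ^+ s *
    (Q_fun (fun i : 'I_6 => pad (v \o s) i) *
     Q_fun (snoc (fun j : 'I_5 => pad (v \o s) (6 + j)%N) y)) = 0.
Proof.
pose w : 'I_(6 + 6) -> N := snoc v y.
pose T (s : 'S_(6 + 6)) := (-1) ^+ s * Q_pair (fun i => w (s i)).
have S0 : \sum_(s : 'S_12 | s ord_max == ord_max) T s = 0.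
  have := Q_pair_altsum0 w; rewrite -/T.
  (* The terms are sorted by the position [p] at which [y] is inserted. The 12 classes have equal
     sums, so each sum is 0. *)
  rewrite (partition_big (fun s : 'S_(6 + 6) => (s^-1)%g ord_max) xpredT) //=.
  rewrite (eq_bigr (fun => \sum_(s : 'S_12 | s ord_max == ord_max) T s)) => [|p _].
    rewrite sumr_const card_ord => /eqP; rewrite mulrn_eq0 => /orP[//|/eqP //].
  have [c [cp cQ]] := Q_pair_move_last p.
  rewrite (reindex_inj (mulgI c)); apply: eq_big => s.
    by rewrite invMg permM (canF_eq (permKV c)) cp (canF_eq (permKV s)) eq_sym.
  move=> _; rewrite /T -[X in _ = _ * X]cQ [RHS]mulrA odd_permM signr_addb.
  rewrite [(-1) ^+ c * _]mulrC; congr (_ * Q_pair _).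
  by apply/funext => i; rewrite permM.
rewrite -[RHS]S0 (sum_lift_perm_max T); apply: eq_bigr => s _.
rewrite /T odd_lift_perm addbb addFb; congr (_ * (Q_fun _ * Q_fun _)).
  apply/funext => i; have i11 : (i < 11)%N by apply: leq_trans (ltn_ord i) _.
  have -> : lshift 6 i = lift ord_max (Ordinal i11) :> 'I_12.
    by apply: val_inj; rewrite /= /bump leqNgt i11.
  by rewrite lift_perm_lift /w snoc_lift -[nat_of_ord i]/(val (Ordinal i11)) pad_ord.
apply/funext => i; case: (unliftP ord_max i) => [j|] ->.
  rewrite snoc_lift; have j11 : (6 + j < 11)%N by rewrite (ltn_add2l 6 j 5).
  have -> : rshift 6 (lift ord_max j) = lift ord_max (Ordinal j11) :> 'I_12.
    by apply: val_inj; rewrite /= /bump [(11 <= _)%N]leqNgt j11 leqNgt ltn_ord.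
  by rewrite lift_perm_lift /w snoc_lift -[(6 + j)%N]/(val (Ordinal j11)) pad_ord.
have -> : rshift 6 ord_max = ord_max :> 'I_12 by apply: val_inj.
by rewrite lift_perm_id /w !snoc_max.
Qed.

End QSquare.

(** * Nonvanishing of Q *)

Section QNonzero.
Variable C : numFieldType.
Local Notation N := (symtl C 6).
Local Notation "# k" := (@Ordinal 6 k isT) (at level 2, format "# k").

(* For i = 2k the matrix diag(1, -1) and for i = 2k+1 the matrix of the swap, *)
(* both in the coordinates 2k, 2k+1: the only nonzero commutators are those   *)
(* of the two matrices of a same block.                                       *)
Definition torus_entry (i x y : nat) : int :=
  if odd i then
    Posz (((x == i.-1) && (y == i)) || ((x == i) && (y == i.-1)))
  else Posz ((x == i) && (y == i)) - Posz ((x == i.+1) && (y == i.+1)).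

(** The infinitesimal rotation of the plane of coordinates 2k, 2k+1. Its entries also serve, up to
    the factor 2, as the structure constants of the commutators of the [torus] matrices. *)
Definition plane_entry (k x y : nat) : int :=
  Posz ((x == k.*2) && (y == k.*2.+1)) - Posz ((x == k.*2.+1) && (y == k.*2)).

(** The entries are integers and sums are written with [foldr], so that these identities are settled
    by computation before being mapped to [C]. *)
Lemma torus_entry_sym : all (fun i => all (fun x => all (fun y =>
  torus_entry i x y == torus_entry i y x) (iota 0 6)) (iota 0 6)) (iota 0 6).
Proof. by vm_compute. Qed.

Lemma torus_entry_trace : all (fun i =>
  foldr (fun x a => torus_entry i x x + a) 0 (iota 0 6) == 0) (iota 0 6).
Proof. by vm_compute. Qed.

Lemma torus_entry_commutator :
  all (fun i => all (fun j => all (fun x => all (fun y =>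
    foldr (fun z a => torus_entry i x z * torus_entry j z y + a) 0 (iota 0 6) -
    foldr (fun z a => torus_entry j x z * torus_entry i z y + a) 0 (iota 0 6) ==
    foldr (fun k a => 2 * (plane_entry k i j * plane_entry k x y) + a) 0
      (iota 0 3))
  (iota 0 6)) (iota 0 6)) (iota 0 6)) (iota 0 6).
Proof. by vm_compute. Qed.

Lemma sum_foldr_iota n (F : nat -> int) :
  \sum_(i < n) (F i)%:~R = (foldr (fun i a => F i + a) 0 (iota 0 n))%:~R :> C.
Proof.
rewrite -rmorph_sum -(big_mkord xpredT F) /index_iota subn0; congr _%:~R.
by elim: (iota 0 n) => [|i s IH]; rewrite ?big_nil // big_cons IH.
Qed.

Lemma mem_iota_ord n (i : 'I_n) : val i \in iota 0 n.
Proof. by rewrite mem_iota leq0n add0n ltn_ord. Qed.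

Definition torus_mx (i : 'I_6) : 'M[C]_6 := \matrix_(x, y) (torus_entry i x y)%:~R.

Definition plane_mx (k : nat) : 'M[C]_6 := \matrix_(x, y) (plane_entry k x y)%:~R.

Fact torus_mx_symtl i : torus_mx i \in @symtl_pred C 6.
Proof.
apply/andP; split.
  apply/eqP/matrixP => x y; rewrite !mxE.
  have /allP/(_ _ (mem_iota_ord i)) := torus_entry_sym.
  by move=> /allP/(_ _ (mem_iota_ord y))/allP/(_ _ (mem_iota_ord x))/eqP ->.
rewrite /mxtrace; under eq_bigr do rewrite mxE.
rewrite (sum_foldr_iota 6 (fun x => torus_entry i x x)).
by have /allP/(_ _ (mem_iota_ord i))/eqP -> := torus_entry_trace.
Qed.

Definition torus (i : 'I_6) : N := SymTl (torus_mx_symtl i).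

Lemma commutator_torus i j :
  commutator (torus i) (torus j) =
  \sum_(k < 3) (2 * (plane_entry k i j)%:~R) *: plane_mx k.
Proof.
apply/matrixP => x y; rewrite !mxE summxE.
under eq_bigr do rewrite !mxE -intrM.
rewrite (sum_foldr_iota 6 (fun z => torus_entry i x z * torus_entry j z y)).
under eq_bigr do rewrite !mxE -intrM.
rewrite (sum_foldr_iota 6 (fun z => torus_entry j x z * torus_entry i z y)).
have /allP/(_ _ (mem_iota_ord i)) := torus_entry_commutator.
move=> /allP/(_ _ (mem_iota_ord j))/allP/(_ _ (mem_iota_ord x)).
move=> /allP/(_ _ (mem_iota_ord y))/eqP E.
rewrite -intrB E -(sum_foldr_iota 3 (fun k => 2 * (plane_entry k i j * plane_entry k x y))).
by apply: eq_bigr => k _; rewrite !mxE !intrM mulrA.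
Qed.

(** Since [plane_entry] gives both the coefficients and the entries, the alternation of the
    arguments and the one inside [polpf] yield the same number, hence a square; 8 is the product of
    the three factors 2. *)
Lemma Q_fun_torus : Q_fun torus = 8 * \sum_(a < 3) \sum_(b < 3) \sum_(c < 3)
  polpf (plane_mx a) (plane_mx b) (plane_mx c) ^+ 2.
Proof.
pose P a b c (s : 'S_6) : C := (-1) ^+ s * (plane_mx a (s #0) (s #1) *
  plane_mx b (s #2) (s #3) * plane_mx c (s #4) (s #5)).
transitivity (\sum_s \sum_t \sum_(a < 3) \sum_(b < 3) \sum_(c < 3)
    8 * (P a b c s * P a b c t)).
  apply: eq_bigr => s _; rewrite /polpf mulr_sumr; apply: eq_bigr => t _.
  rewrite !commutator_torus !summxE big_distrlr /= mulr_suml !mulr_sumr.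
  apply: eq_bigr => a _; rewrite mulr_suml !mulr_sumr; apply: eq_bigr => b _.
  rewrite !mulr_sumr; apply: eq_bigr => c _; rewrite /P !mxE.
  move: ((-1) ^+ s) ((-1) ^+ t) => x y; ring.
have exch (F : 'S_6 -> 'S_6 -> 'I_3 -> C) : \sum_s \sum_t \sum_i F s t i =
    \sum_i \sum_s \sum_t F s t i.
  by under eq_bigr do rewrite exchange_big; rewrite exchange_big.
rewrite exch mulr_sumr; apply: eq_bigr => a _.
rewrite exch mulr_sumr; apply: eq_bigr => b _.
rewrite exch mulr_sumr; apply: eq_bigr => c _.
rewrite expr2 /polpf big_distrlr mulr_sumr; apply: eq_bigr => s _.
by rewrite mulr_sumr.
Qed.

Lemma plane_mxE k (hk : (k.*2 < 6)%N) (hk' : (k.*2.+1 < 6)%N) :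
  let e := delta_mx (Ordinal hk) 0 *m (delta_mx (Ordinal hk') (0 : 'I_1))^T in
  plane_mx k = e - e^T.
Proof.
move=> e; rewrite /e trmx_mul trmxK !trmx_delta !mul_delta_mx.
by apply/matrixP => x y; rewrite !mxE intrB.
Qed.

(** Three factors 2 from antisymmetrizing, times the determinant of the identity. *)
Lemma polpf_plane_mx : polpf (plane_mx 0) (plane_mx 1) (plane_mx 2) = 8.
Proof.
have P1 (Y A B : 'M[C]_6) : polpf (Y - Y^T) A B = 2 * polpf Y A B.
  have -> : Y - Y^T = (-1) *: Y^T + Y by rewrite scaleN1r addrC.
  rewrite polpf_linear polpf_tr -[(-1) *: _]/(-1 * _).
  by rewrite mulrNN mul1r mulr_natl.
rewrite (@plane_mxE 0 isT isT) (@plane_mxE 1 isT isT) (@plane_mxE 2 isT isT).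
rewrite P1 polpfC12 P1 polpfC23 polpfC12 P1.
rewrite polpfC12 polpfC23 polpfC12.
rewrite (polpf_rank1 (fun i => delta_mx i 0)).
rewrite (_ : (\matrix_(i, j) _) = 1%:M) ?det1 ?mulr1 -?natrM //.
by apply/matrixP => i j; rewrite !mxE eqxx andbT.
Qed.

(** The sum consists of squares of real numbers, and its term at (0, 1, 2) is 64. *)
Lemma Q_fun_torus_neq0 : Q_fun torus != 0.
Proof.
have sqr_ge0 a b c : 0 <= polpf (plane_mx a) (plane_mx b) (plane_mx c) ^+ 2.
  rewrite real_exprn_even_ge0 // rpred_sum // => s _.
  by rewrite !rpredM ?rpredX ?rpredN ?rpred1 // mxE realz.
rewrite Q_fun_torus mulf_neq0 ?pnatr_eq0 //.
apply/negP; rewrite psumr_eq0 => [|a _]; last by do 2!apply: sumr_ge0 => ? _.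
move=> /allP/(_ ord0 (mem_index_enum _)) /=.
rewrite psumr_eq0 => [|a _]; last by apply: sumr_ge0 => ? _.
move=> /allP/(_ (lift ord0 ord0) (mem_index_enum _)) /=.
rewrite psumr_eq0 // => /allP/(_ (lift ord0 (lift ord0 ord0)) (mem_index_enum _)) /=.
by rewrite polpf_plane_mx -natrX pnatr_eq0.
Qed.
End QNonzero.

(** * Gradients of invariant forms *)

Section Orthogonal.
Variables (C : numFieldType) (n : nat) (g : SO C n).

Lemma SO_mulmx_tr : val g *m (val g)^T = 1%:M.
Proof. by case: g => h /= /andP[/eqP]. Qed.

Lemma SO_tr_mulmx : (val g)^T *m val g = 1%:M.
Proof. exact/mulmx1C/SO_mulmx_tr. Qed.

Lemma SO_invmx : invmx (val g) = (val g)^T.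
Proof.
have [gU _] := mulmx1_unit SO_mulmx_tr.
by rewrite -[RHS](mulKmx gU) SO_mulmx_tr mulmx1.
Qed.

End Orthogonal.

Section Gradient.
Variables (C : numFieldType) (n : nat).
Local Notation N := (symtl C n.+1).

(** The orthogonal projection onto [N] for the form tr(A^T B). It allows a form on [N] to be tested
    on elementary matrices, which need not lie in [N]. *)
Definition symtl_proj_mx (A : 'M[C]_n.+1) : 'M[C]_n.+1 :=
  2^-1 *: (A + A^T) - (\tr A / n.+1%:R) *: 1%:M.

Fact symtl_proj_subproof A : symtl_proj_mx A \in @symtl_pred C n.+1.
Proof.
apply/andP; split; apply/eqP.
  by apply/matrixP => i j; rewrite !mxE eq_sym [A j i + _]addrC.
rewrite linearB !linearZ /= linearD /= mxtrace_tr mxtrace1 divfK ?pnatr_eq0 //.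
by rewrite -mulr2n -[\tr A *+ 2]mulr_natl mulKf ?pnatr_eq0 ?subrr.
Qed.

Definition symtl_proj A : N := SymTl (symtl_proj_subproof A).

Lemma symtl_proj_linear : linear symtl_proj.
Proof.
move=> a A B; apply: val_inj; rewrite /= /symtl_proj_mx !linearP /=.
apply/matrixP => i j; rewrite !mxE; ring.
Qed.

Lemma symtl_proj_tr A : symtl_proj A^T = symtl_proj A.
Proof.
by apply: val_inj; rewrite /= /symtl_proj_mx trmxK mxtrace_tr [A^T + A]addrC.
Qed.

Lemma symtl_proj1 : symtl_proj 1%:M = 0.
Proof.
apply: val_inj; rewrite /= /symtl_proj_mx trmx1 mxtrace1 divff ?pnatr_eq0 //.
by rewrite -mulr2n -scaler_nat scalerA mulVf ?pnatr_eq0 ?subrr.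
Qed.

Lemma symtl_proj_id (X : N) : symtl_proj (val X) = X.
Proof.
apply: val_inj; case: X => X /= /andP[/eqP sX /eqP tX].
rewrite /symtl_proj_mx sX tX mul0r scale0r subr0 -mulr2n -scaler_nat scalerA.
by rewrite mulVf ?pnatr_eq0 ?scale1r.
Qed.

Lemma symtl_proj_conj (g : SO C n.+1) A :
  symtl_proj (val g *m A *m (val g)^T) = conj_symtl g (symtl_proj A).
Proof.
apply: val_inj; rewrite /= /symtl_proj_mx SO_invmx mulmxBr mulmxBl.
rewrite -!scalemxAr -!scalemxAl mulmxDr mulmxDl !trmx_mul trmxK mulmxA mulmx1.
by rewrite SO_mulmx_tr mxtrace_mulC mulmxA SO_tr_mulmx mul1mx.
Qed.

Section Def.
Variables (k : nat) (f : ('I_k.+1 -> N) -> C^o).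

Definition gradient_mx (v : 'I_k -> N) : 'M[C]_n.+1 :=
  \matrix_(i, j) f (snoc v (symtl_proj (delta_mx i j))).

Hypothesis fL : multilinear f.

Lemma snoc_upd_max (v : 'I_k -> N) x y :
  upd (snoc v x) ord_max y = snoc v y.
Proof.
apply/funext => i; rewrite /upd; case: (unliftP ord_max i) => [j|] ->.
  by rewrite -[_ == _]negbK eq_sym neq_lift /= !snoc_lift.
by rewrite eqxx snoc_max.
Qed.

Lemma snoc_upd_lift (v : 'I_k -> N) i x y :
  snoc (upd v i x) y = upd (snoc v y) (lift ord_max i) x.
Proof.
apply/funext => j; rewrite /upd; case: (unliftP ord_max j) => [j'|] ->.
  by rewrite !snoc_lift (inj_eq (@lift_inj _ _)).
by rewrite (negPf (neq_lift _ _)) !snoc_max.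
Qed.

Lemma snoc_linear v : linear (fun y => f (snoc v y)).
Proof. by move=> a x y; have := fL (snoc v 0) ord_max a x y; rewrite !snoc_upd_max. Qed.

Lemma snoc_proj_linear v : linear (fun A => f (snoc v (symtl_proj A))).
Proof. by move=> a A B; rewrite symtl_proj_linear snoc_linear. Qed.

Lemma gradient_mxE v A :
  f (snoc v (symtl_proj A)) = \tr (A^T *m gradient_mx v).
Proof.
pose L : {linear 'M[C]_n.+1 -> C^o} := HB.pack (fun A => f (snoc v (symtl_proj A)))
  (GRing.isLinear.Build _ _ _ _ _ (snoc_proj_linear v)).
rewrite -[LHS]/(L A) [in LHS](matrix_sum_delta A) linear_sum.
under eq_bigr do rewrite linear_sum.
rewrite exchange_big /=; apply: eq_bigr => j _; rewrite mxE; apply: eq_bigr => i _.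
by rewrite -[LHS]/(L (A i j *: delta_mx i j)) linearZ_LR !mxE.
Qed.

(** Symmetric because the projection ignores transposition, traceless because it kills the
    identity. *)
Fact gradient_subproof v : gradient_mx v \in @symtl_pred C n.+1.
Proof.
apply/andP; split; apply/eqP.
  by apply/matrixP => i j; rewrite !mxE -symtl_proj_tr trmx_delta.
have := gradient_mxE v 1%:M; rewrite trmx1 mul1mx symtl_proj1 => <-.
have := snoc_linear v (-1) 0 0; rewrite !scaleN1r oppr0 addr0 => ->.
by rewrite addNr.
Qed.

Definition gradient v : N := SymTl (gradient_subproof v).

Lemma gradient_eq0 v y : gradient v = 0 -> f (snoc v y) = 0.
Proof.
move=> /(congr1 val) /= v0.
by rewrite -(symtl_proj_id y) gradient_mxE v0 mulmx0 mxtrace0.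
Qed.

Lemma gradient_covariants : alternating f ->
  (forall g v, f (fun i => conj_symtl g (v i)) = f v) ->
  covariants (@conj_symtl C n.+1) (homog gradient).
Proof.
move=> fA fG; apply: homog_covariants => [g|v i a x y|v i j ij vij|g v].
- by apply: val_inj; rewrite /= mulmx0 mul0mx.
- by apply: val_inj; apply/matrixP => p q; rewrite !mxE !snoc_upd_lift fL.
- apply: val_inj; apply/matrixP => p q; rewrite !mxE.
  apply: (fA _ (lift ord_max i) (lift ord_max j)); last by rewrite !snoc_lift.
  by rewrite (inj_eq (@lift_inj _ _)).
apply: val_inj; rewrite /= SO_invmx; apply/matrixP => i j; rewrite mxE.
(* The last argument is made a conjugate too, so that the invariance of [f] applies to the whole
   tuple. *)
have -> : symtl_proj (delta_mx i j) =
    conj_symtl g (symtl_proj ((val g)^T *m delta_mx i j *m val g)).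
  rewrite -symtl_proj_conj !mulmxA SO_mulmx_tr mul1mx -mulmxA.
  by rewrite SO_mulmx_tr mulmx1.
have -> y : snoc (fun l => conj_symtl g (v l)) (conj_symtl g y) =
    fun l => conj_symtl g (snoc v y l).
  apply/funext => l; case: (unliftP ord_max l) => [l'|] ->.
    by rewrite !snoc_lift.
  by rewrite !snoc_max.
rewrite fG gradient_mxE !trmx_mul trmxK trmx_delta -!mulmxA mxtrace_mulC -!mulmxA.
set B := _ *m (_ *m _).
rewrite /mxtrace (bigD1 j) //= big1 ?addr0 => [|l lj].
  rewrite mxE (bigD1 i) //= big1 ?addr0 => [|l li].
    by rewrite mxE !eqxx mul1r.
  by rewrite mxE (negPf li) andbF mul0r.
by rewrite mxE big1 // => m _; rewrite mxE (negPf lj) mul0r.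
Qed.

End Def.

End Gradient.

(** * Components of low degree *)

Section FixedPoints.
Variables (C : numFieldType) (n : nat).

Definition signed_perm_mx (d : 'I_n -> bool) (t : 'S_n) : 'M[C]_n :=
  diag_mx (\row_i (-1) ^+ d i) *m perm_mx t.

Fact signed_perm_subproof (d : 'I_n -> bool) (t : 'S_n) :
  (\prod_i (-1) ^+ d i) * (-1) ^+ t = 1 :> C ->
  (signed_perm_mx d t *m (signed_perm_mx d t)^T == 1%:M) &&
    (\det (signed_perm_mx d t) == 1).
Proof.
move=> dt; rewrite /signed_perm_mx; apply/andP; split; apply/eqP; last first.
  by rewrite det_mulmx det_diag det_perm -[RHS]dt; under eq_bigr do rewrite mxE.
rewrite trmx_mul tr_perm_mx tr_diag_mx mulmxA -[X in X *m _]mulmxA -perm_mxM.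
rewrite mulgV perm_mx1 mulmx1 mulmx_diag; apply/matrixP => i j.
by rewrite !mxE -signr_addb addbb.
Qed.

Lemma fixed_signed_perm (x : symtl C n) (d : 'I_n -> bool) (t : 'S_n) :
  (forall g, conj_symtl g x = x) ->
  (\prod_i (-1) ^+ d i) * (-1) ^+ t = 1 :> C ->
  forall i j, (-1) ^+ d i * val x (t i) (t j) = val x i j * (-1) ^+ d j.
Proof.
move=> fix_x dt i j.
pose g : SO C n := exist _ (signed_perm_mx d t) (signed_perm_subproof dt).
have /(congr1 (fun y => val y *m val g)) := fix_x g; rewrite /= (SO_invmx g).
rewrite -mulmxA (SO_tr_mulmx g) mulmx1 /= => /matrixP/(_ i (t j)).
rewrite /signed_perm_mx -mulmxA [symtl_val x *m (_ *m _)]mulmxA.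
rewrite -row_permE mul_diag_mx mul_mx_diag -[t in perm_mx t]invgK -col_permE.
by rewrite !mxE permK.
Qed.

(** Changing the signs of coordinate i and of a third coordinate k kills the entry (i, j). A
    transposition with one sign change makes the diagonal entries equal, and the trace is 0. *)
Lemma fixed_symtl_eq0 (x : symtl C n) : (2 < n)%N ->
  (forall g, conj_symtl g x = x) -> x = 0.
Proof.
move=> n2 fix_x.
have off i j : i != j -> val x i j = 0.
  move=> ij; have [k] : exists k, k \notin [set i; j].
    apply/existsP; rewrite -negb_forall; apply/negP => /forallP all_ij.
    have : [set: 'I_n] \subset [set i; j] by apply/fintype.subsetP => k _.
    by move/subset_leq_card; rewrite cards2 ij cardsT card_ord leqNgt n2.
  rewrite !inE negb_or => /andP[ki kj].
  have dt : (\prod_l (-1) ^+ ((l == i) || (l == k))) * (-1) ^+ (1%g : 'S_n) = 1 :> C.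
    rewrite odd_perm1 mulr1 (bigD1 i) //= eqxx (bigD1 k) //= eqxx orbT.
    rewrite big1 ?mulr1 ?mulrNN ?mulr1 // => l /andP[/negPf -> /negPf ->]; exact: expr0.
  have := fixed_signed_perm fix_x dt i j.
  rewrite !perm1 eqxx [j == i]eq_sym (negPf ij) [j == k]eq_sym (negPf kj) /=.
  rewrite mulr1 mulN1r => /eqP.
  by rewrite eq_sym -addr_eq0 -mulr2n mulrn_eq0 => /eqP.
have diag i j : val x i i = val x j j.
  have [-> //|ij] := eqVneq i j.
  have dt : (\prod_l (-1) ^+ (l == i)) * (-1) ^+ tperm i j = 1 :> C.
    rewrite odd_tperm ij (bigD1 i) //= eqxx big1 ?mulr1 ?mulrNN ?mulr1 //.
    by move=> l /negPf ->.
  have := fixed_signed_perm fix_x dt i i.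
  by rewrite tpermL eqxx mulN1r mulrN1 => /oppr_inj.
apply: val_inj; apply/matrixP => i j; rewrite mxE.
have [<-|/off //] := eqVneq i j.
have /andP[_ /eqP] := valP x; rewrite /mxtrace (eq_bigr (fun=> val x i i)) => [|l _].
  rewrite sumr_const card_ord => /eqP.
  by rewrite mulrn_eq0 => /orP[/eqP n0|/eqP //]; rewrite n0 in n2.
exact: diag.
Qed.

End FixedPoints.

Section Degrees.
Variables (C : numFieldType) (N : lmodType C).

Lemma homogE (V : lmodType C) k (f : ('I_k -> N) -> V) v : homog f v = f v.
Proof.
rewrite /homog; case: eqP => [e|//]; congr f; apply/funext => i.
by congr v; apply: val_inj.
Qed.

Lemma homog_neq (V : lmodType C) k (f : ('I_k -> N) -> V) m (v : 'I_m -> N) :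
  k != m -> homog f v = 0.
Proof. by rewrite /homog; case: eqP. Qed.

Lemma form_degree0 (V : lmodType C) (H : form N V) (v w : 'I_0 -> N) : H 0%N v = H 0%N w.
Proof. by congr (H 0%N); apply/funext => -[]. Qed.

Section Shuffle.
Variable V : lmodType C.

Lemma shuffle_sum0l h k (f : ('I_h -> N) -> C^o) (g : ('I_k -> N) -> V) m
  (v : 'I_m -> N) : (forall x, f x = 0) -> shuffle_sum f g v = 0.
Proof. by move=> f0; apply: big1 => s _; rewrite f0 scale0r scaler0. Qed.

Lemma shuffle_sum0r h k (f : ('I_h -> N) -> C^o) (g : ('I_k -> N) -> V) m
  (v : 'I_m -> N) : (forall x, g x = 0) -> shuffle_sum f g v = 0.
Proof. by move=> g0; apply: big1 => s _; rewrite g0 !scaler0. Qed.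

(** All [k!] terms coincide, the sign of [s] occurring twice; [z] names the only tuple of length
    0. *)
Lemma shuffle_sum_degree0l (F : form N C^o) k (g : ('I_k -> N) -> V) v z :
  (forall w (s : 'S_k), g (fun i => w (s i)) = (-1) ^+ s *: g w) ->
  shuffle_sum (F 0%N) g v = k`!%:R *: ((F 0%N z : C) *: g v).
Proof.
move=> g_alt; rewrite scaler_nat -sum_perm_const; apply: eq_bigr => s _.
rewrite (form_degree0 F _ z) (_ : (fun j => _) = fun j => v (s j)).
  by rewrite g_alt [LHS]scaleCA [X in _ *: X]scalerA -signr_addb addbb scale1r.
by apply/funext => j; rewrite add0n pad_ord.
Qed.

Lemma shuffle_sum_degree0r (H : form N V) k (f : ('I_k -> N) -> C^o) v z :
  (forall w (s : 'S_k), f (fun i => w (s i)) = (-1) ^+ s * f w) ->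
  shuffle_sum f (H 0%N) v = k`!%:R *: ((f v : C) *: H 0%N z).
Proof.
move=> f_alt; rewrite scaler_nat -sum_perm_const; apply: eq_bigr => s _.
rewrite (form_degree0 H _ z) (_ : (fun i => _) = fun i => v (s i)).
  by rewrite f_alt !scalerA mulrA -signr_addb addbb mul1r.
by apply/funext => j; rewrite pad_ord.
Qed.

(** The spanning condition of [free_module] allows repeated basis elements while independence asks
    for an injective family; coefficients of equal elements are added. *)
Lemma wedge_merge (A : set (form N C^o)) (B : set (form N V)) m
    (a : 'I_m -> form N C^o) (b : 'I_m -> form N V) :
  A 0 -> (forall F G, A F -> A G -> A (F + G)) ->
  (forall j, A (a j)) -> (forall j, B (b j)) ->
  exists p (a' : 'I_p -> form N C^o) (b' : 'I_p -> form N V),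
    [/\ forall i, A (a' i), forall i, B (b' i), injective b'
      & \sum_(j < m) wedge (a j) (b j) = \sum_(i < p) wedge (a' i) (b' i)].
Proof.
move=> A0 AD Aa Bb; pose s := undup [seq b j | j : 'I_m].
pose b' (i : 'I_(size s)) := nth 0 s i.
have b'P i : exists j, b' i = b j.
  have : b' i \in s by apply: mem_nth.
  by rewrite mem_undup => /mapP[j _ ->]; exists j.
have b'_inj : injective b'.
  by move=> i j /eqP; rewrite nth_uniq ?undup_uniq // => /eqP/val_inj.
exists (size s), (fun i => \sum_(j | b j == b' i) a j), b'; split=> //.
- by move=> i; apply: big_ind.
- by move=> i; have [j ->] := b'P i.
transitivity (\sum_(j < m) \sum_(i | b j == b' i) wedge (a j) (b j)).
  apply: eq_bigr => j _.
  have js : b j \in s by rewrite mem_undup map_f ?mem_enum.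
  have ilt : (index (b j) s < size s)%N by rewrite index_mem.
  rewrite (big_pred1 (Ordinal ilt)) // => i; rewrite /= -[in LHS](nth_index 0 js).
  by rewrite eq_sym -[nth 0 s _]/(b' (Ordinal ilt)) (inj_eq b'_inj).
rewrite (exchange_big_dep xpredT) //=; apply: eq_bigr => i _.
by rewrite wedge_suml; apply: eq_bigr => j /eqP ->.
Qed.

End Shuffle.
End Degrees.

Section LowDegree.
Variable C : numFieldType.
Local Notation N := (symtl C 6).

Lemma T1_fun_perm (v : 'I_5 -> N) (t : 'S_5) :
  T1_fun (fun i => v (t i)) = (-1) ^+ t * T1_fun v.
Proof.
rewrite !T1_funE.
exact: (altsum_perm (fun w : 'I_5 -> N => \tr (\prod_(i < 5) val (w i)) : C^o)).
Qed.

(** An upper bound for the generated subalgebra, with no condition in degree 0 or in degrees above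
    5. *)
Definition low_degree_form : set (form N C^o) := [set F : form N C^o |
  (forall k (v : 'I_k -> N), (0 < k < 5)%N -> F k v = 0) /\
  exists c : C, forall v, F 5 v = c * T1_fun v]%classic.

(** Only the bidegrees (0, 5) and (5, 0) survive. As [H] is not assumed alternating, the first stays
    a [shuffle_sum]. *)
Lemma wedge_degree5 (V : lmodType C) (F : form N C^o) (H : form N V) v z
    (c : C) : (forall k (v : 'I_k -> N), (0 < k < 5)%N -> F k v = 0) ->
  (forall v, F 5 v = c * T1_fun v) ->
  wedge F H v = 5`!%:R^-1 *: shuffle_sum (F 0%N) (H 5) v +
    (c * T1_fun v) *: H 0%N z.
Proof.
move=> F0 F5; rewrite wedgeE (bigD1 ord0) //= (bigD1 ord_max) //= big1.
  rewrite addr0 mul1r (shuffle_sum_degree0r H v z).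
    rewrite F5 mulr1 [X in _ + X]scalerA mulVf ?scale1r //.
    by rewrite pnatr_eq0 -lt0n fact_gt0.
  by move=> w s; rewrite !F5 T1_fun_perm mulrCA.
move=> h /andP[h0 h5]; rewrite shuffle_sum0l ?scaler0 // => x; apply: F0.
by rewrite lt0n h0 ltn_neqAle h5 -ltnS ltn_ord.
Qed.

Lemma low_degree_subalgebra : subalgebra low_degree_form.
Proof.
split.
- split; first by move=> k v /andP[k0 _]; apply: homog_neq; rewrite eq_sym -lt0n.
  by exists 0 => v; rewrite mul0r; apply: homog_neq.
- move=> a F G [F0 [c F5]] [G0 [d G5]]; split=> [k v k5|].
    by rewrite addformE G0 // addr0 -[LHS]/(a *: F k v) F0 // scaler0.
  exists (a * c + d) => v; rewrite addformE G5 mulrDl -mulrA -F5 //.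
move=> F G [F0 [c F5]] [G0 [d G5]]; split=> [k v /andP[k0 k5]|].
  rewrite wedgeE big1 // => h _; case: (posnP h) => [h0|h_gt0].
    rewrite shuffle_sum0r ?scaler0 // => x; apply: G0.
    by rewrite h0 subn0 k0.
  rewrite shuffle_sum0l ?scaler0 // => x; apply: F0.
  by rewrite h_gt0 (leq_ltn_trans _ k5) // -ltnS.
pose z (i : 'I_0) : N := 0.
exists (F 0%N z * d + c * G 0%N z) => v.
rewrite (wedge_degree5 _ v z F0 F5) (shuffle_sum_degree0l F v z).
  rewrite [X in X + _]scalerA mulVf ?scale1r ?pnatr_eq0 -?lt0n ?fact_gt0 //.
  by rewrite G5 mulrDl; congr (_ + _); [exact: mulrA|exact: mulrAC].
by move=> w s; rewrite !G5 T1_fun_perm; exact: mulrCA.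
Qed.

Lemma low_degree_T1 : low_degree_form (T1 C).
Proof.
split=> [k v /andP[_ k5]|]; last by exists 1 => v; rewrite mul1r; apply: homogE.
by apply: homog_neq; rewrite eq_sym neq_ltn k5.
Qed.

Lemma low_degree_Q : low_degree_form (Q C).
Proof.
split=> [k v /andP[_ k5]|]; last by exists 0 => v; rewrite mul0r; apply: homog_neq.
by apply: homog_neq; rewrite eq_sym neq_ltn (ltn_trans k5).
Qed.

(** In degree 6 the product is [Q_fun] times the constant term of [F]; it is evaluated at [torus],
    where [Q_fun] is nonzero. *)
Lemma wedge_Q_eq0_degree0 (F : form N C^o) z : wedge (Q C) F = 0 -> F 0%N z = 0.
Proof.
move=> /(congr1 (fun G : form N C^o => G 6 (@torus C))).
rewrite wedgeE (bigD1 ord_max) //= big1 => [|h h6]; last first.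
  by rewrite shuffle_sum0l ?scaler0 // => x; apply: homog_neq; rewrite eq_sym.
have Q6 : @homog C N C^o 6 (@Q_fun C) 6 = @Q_fun C.
  by apply/funext => v; apply: homogE.
rewrite addr0 [Q C 6]Q6 (shuffle_sum_degree0r F _ z); last exact: Q_fun_perm.
move/eqP; rewrite !scaler_eq0 invr_eq0 mulf_eq0 !pnatr_eq0.
by rewrite (negPf (Q_fun_torus_neq0 C)) => /eqP.
Qed.

End LowDegree.

(** * The gradient of [Q] and its annihilation by [Q] *)

Section QGradient.
Variable C : numFieldType.
Local Notation N := (symtl C 6).

Lemma Q_degree6 : @homog C N C^o 6 (@Q_fun C) 6 = @Q_fun C.
Proof. by apply/funext => v; apply: homogE. Qed.

Lemma Q_fun_multilinear : multilinear (@Q_fun C : ('I_5.+1 -> N) -> C^o).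
Proof. by have [+ _ _] := Q_covariants C 6; rewrite [Q C 6]Q_degree6. Qed.

Definition Q_gradient : form N N := homog (gradient Q_fun_multilinear).

Lemma Q_gradient_covariants : covariants (@conj_symtl C 6) Q_gradient.
Proof.
have [_ + +] := Q_covariants C 6; rewrite [Q C 6]Q_degree6 => QA QG.
exact: gradient_covariants.
Qed.

Lemma Q_gradient_neq0 : exists v : 'I_5 -> N, Q_gradient v != 0.
Proof.
exists (fun i => torus C (lift ord_max i)); rewrite [Q_gradient _]homogE.
apply/eqP => /(gradient_eq0 (torus C ord_max))/eqP.
rewrite (_ : snoc _ _ = torus C) ?(negPf (Q_fun_torus_neq0 C)) //.
apply/funext => i; case: (unliftP ord_max i) => [j|] ->.
  by rewrite snoc_lift.
by rewrite snoc_max.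
Qed.

(** The entry (i, j) is [Q_wedge_gradient0] contracted with the projection of an elementary
    matrix. *)
Lemma shuffle_Q_gradient (v : 'I_11 -> N) :
  shuffle_sum (Q C 6) (Q_gradient (k := 5)) v = 0.
Proof.
have val_sum (I : finType) (F : I -> N) : val (\sum_i F i) = \sum_i val (F i).
  exact: (big_morph (@symtl_val C 6)).
apply: val_inj; rewrite val_sum; apply/matrixP => i j; rewrite summxE mxE.
rewrite -[RHS](Q_wedge_gradient0 v (symtl_proj (delta_mx i j))).
by apply: eq_bigr => s _; rewrite [Q C 6 _]homogE [Q_gradient _]homogE !mxE.
Qed.

Lemma wedge_Q_gradient : wedge (Q C) Q_gradient = 0.
Proof.
apply: formP => m v; rewrite wedgeE big1 // => h _.
have [h6|h6] := eqVneq 6 (h : nat); last first.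
  by rewrite shuffle_sum0l ?scaler0 // => x; apply: homog_neq.
have [m5|m5] := eqVneq 5 (m - h)%N; last first.
  by rewrite shuffle_sum0r ?scaler0 // => x; apply: homog_neq.
have m11 : 11 = m by rewrite -(subnK (leq_ord h)) -m5 -h6.
(* The degrees are generalized to variables because the types of the components depend on them. *)
have shuffle0 a b : 6 = a -> 5 = b ->
    shuffle_sum (Q C a) (Q_gradient (k := b)) v = 0.
  by move=> <- <-; case: m / m11 v {h h6 m5} => v; apply: shuffle_Q_gradient.
by rewrite shuffle0 ?scaler0.
Qed.

End QGradient.

(** * Failure of freeness *)

Lemma smallest_subalgebra (C : numFieldType) (N : lmodType C)
    (S : set (form N C^o)) : subalgebra (generated_subalgebra S).
Proof.
split=> [A [[] //]|a F G AF AG A AS|F G AF AG A AS].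
  by have [[_ + _] _] := AS; apply; [apply: AF|apply: AG].
by have [[_ _ +] _] := AS; apply; [apply: AF|apply: AG].
Qed.

Local Open Scope classical_set_scope.

Theorem mainTheorem4 (R : realType) :
  ~ free_module (generated_subalgebra [set T1 R[i]; Q R[i]])
      (covariants (@conj_symtl R[i] 6)).
Proof.
move=> [B [B_cov B_span B_indep]]; set A := generated_subalgebra _ in B_span B_indep.
have [A1 A_lin A_wedge] : subalgebra A by apply: smallest_subalgebra.
have A_low : (A `<=` @low_degree_form R[i])%classic.
  apply: smallest_sub; first exact: low_degree_subalgebra.
  by move=> F [->|->]; [apply: low_degree_T1|apply: low_degree_Q].
have AQ : A (Q R[i]) by apply: sub_gen_smallest; right.
have A0 : A 0 by have := A_lin (-1) _ _ A1 A1; rewrite scaleN1r addNr.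
have AD F G : A F -> A G -> A (F + G).
  by move=> AF AG; have := A_lin 1 _ _ AF AG; rewrite scale1r.
have [m [a [b [Aa Bb grad_ab]]]] := B_span _ (Q_gradient_covariants R[i]).
have [p [a' [b' [Aa' Bb' b'_inj ab']]]] := wedge_merge A0 AD Aa Bb.
(* Multiplying the expansion of the gradient by [Q] gives, by associativity, a relation with
   coefficients in [A]. *)
have Qa' : forall i, wedge (Q R[i]) (a' i) = 0.
  apply: (B_indep _ _ _ _ Bb' b'_inj) => [i|]; first exact: A_wedge.
  under eq_bigr do rewrite -wedgeA.
  by rewrite -wedge_sumr -ab' -grad_ab wedge_Q_gradient.
have [v] := Q_gradient_neq0 R[i]; rewrite grad_ab ab'.
have sumE q (F : 'I_q -> form (symtl R[i] 6) (symtl R[i] 6)) :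
    (\sum_i F i) 5%N v = \sum_i F i 5%N v.
  exact: (big_morph (fun G : form _ _ => G 5%N v)).
rewrite sumE big1 ?eqxx // => i _.
have [a_low [c a_5]] := A_low _ (Aa' i).
pose z (l : 'I_0) : symtl R[i] 6 := 0.
(* The bidegree (0, 5) vanishes with the constant term of [a' i]; in bidegree (5, 0) the value of
   [b' i] is a fixed point of SO(6), hence 0. *)
rewrite (wedge_degree5 (b' i) v z a_low a_5) shuffle_sum0l ?scaler0 ?add0r.
  rewrite [X in _ *: X](@fixed_symtl_eq0 _ 6) ?scaler0 // => g.
  have [_ _ /(_ g z) <-] := B_cov _ (Bb' i) 0%N.
  exact: form_degree0.
by move=> w; apply: wedge_Q_eq0_degree0 (Qa' i).
Qed.
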